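(* Let $n\ge1$ be an integer, $\alpha\in(0,1)$, $s\in(0,1)$, $p>0$, and let $\Omega\subset\mathbb{R}^{n+1}$ be an open convex set. Then, for every measurable $E\subset\partial\Omega$ with finite positive measure and a.e. $x\in E$, it holds $$|E|^{-\frac{sp}{n}}\le C\left(\int_{\partial\Omega\setminus E}\frac{dy}{|x-y|^{n+sp}}+H_\alpha(x)^{\frac{sp}{\alpha}}\right)$$ for some constant $C$ depending only on $n$, $\alpha$, $s$, and $p$.
   Context: On $\partial\Omega$, $|E|$ denotes the $n$-dimensional Hausdorff measure of $E$, $dy$ integration with respect to it, and ''measurable'' and ''a.e.'' refer to it; $|x-y|$ is the Euclidean distance in $\mathbb{R}^{n+1}$. The nonlocal $\alpha$-mean curvature of $\Omega$ at $x\in\partial\Omega$ is $$H_\alpha(x)=\frac{\alpha}{2}\,\mathrm{P.V.}\int_{\mathbb{R}^{n+1}}\frac{\chi_{\mathbb{R}^{n+1}\setminus\Omega}(y)-\chi_\Omega(y)}{|y-x|^{n+1+\alpha}}\,dy=\mathrm{P.V.}\int_{\partial\Omega}\frac{(y-x)\cdot\nu(y)}{|y-x|^{n+1+\alpha}}\,dy,$$ where $\nu$ is the exterior unit normal to $\partial\Omega$ (defined a.e.), the first integral is with respect to Lebesgue measure, and P.V. denotes the principal value. For convex $\Omega$ the last integrand is non-negative, so $H_\alpha(x)\in[0,+\infty]$ is well defined. The right-hand side of the inequality is allowed to be $+\infty$. *)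

(* Defs.v *)
From HB Require Import structures.
From mathcomp Require Import all_boot all_order all_algebra.
From mathcomp Require Import all_classical all_reals all_analysis.

Set SsrOldRewriteGoalsOrder.
Set Implicit Arguments.
Unset Strict Implicit.
Unset Printing Implicit Defensive.
Import Order.TTheory GRing.Theory Num.Theory.
Import numFieldNormedType.Exports.

Local Open Scope classical_set_scope.
Local Open Scope ring_scope.

(* The library norm `|x| on row vectors is the sup norm; it induces the same
   topology as enorm, but distances have to be measured with enorm. *)
Definition enorm (R : realType) (m : nat) (x : 'rV[R]_m) : R :=
  Num.sqrt (\sum_(i < m) x ord0 i ^+ 2).

Definition boundary (T : topologicalType) (A : set T) : set T :=
  closure A `\` interior A.

(* Caratheodory's method I: the outer measure of X is the infimum of the total
   weight of the countable covers of X by sets S i with i in D. *)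
Section cover_outer.
Local Open Scope ereal_scope.
Context (R : realType) (T I : Type).
Variables (D : set I) (S : I -> set T) (w : I -> \bar R).

Definition cover_outer (X : set T) : \bar R :=
  ereal_inf [set \sum_(k <oo) w (F k) | F in
    [set F : nat -> I | (forall k, D (F k)) /\ X `<=` \bigcup_k S (F k)]].

Hypothesis w_ge0 : forall i, D i -> 0 <= w i.

Lemma cover_outer_ge0 X : 0 <= cover_outer X.
Proof.
apply: le_ereal_inf_tmp => x [F [DF _] <-{x}].
by apply: nneseries_ge0 => k _ _; exact: w_ge0.
Qed.

Lemma le_cover_outer : {homo cover_outer : A B / A `<=` B >-> A <= B}.
Proof.
move=> A B AB; apply: ereal_inf_le_tmp => x [F [DF BF]] <-{x}.
by exists F => //; split => //; exact: subset_trans BF.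
Qed.

Lemma cover_outer0 i0 : D i0 -> w i0 = 0 -> cover_outer set0 = 0.
Proof.
move=> Di0 wi0; apply/eqP; rewrite eq_le cover_outer_ge0 andbT.
apply: ereal_inf_lbound; exists (fun=> i0); first by split.
by apply: eseries0 => k _ _.
Qed.

Lemma cover_outer_sigma_subadditive : sigma_subadditive cover_outer.
Proof.
move=> A; have [[i ioo]|] := pselect (exists i, cover_outer (A i) = +oo).
  rewrite (eseries_pinfty _ _ ioo) ?leey// => n _.
  by rewrite -ltNye (lt_le_trans _ (cover_outer_ge0 _)).
rewrite -forallNE => Aoo.
suff add2e (e : {posnum R}) : cover_outer (\bigcup_n A n) <=
    \sum_(i <oo) cover_outer (A i) + e%:num%:E.
  by apply/lee_addgt0Pr => _/posnumP[].
rewrite (le_trans _ (epsilon_trick _ _ _))//; last first.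
  by move=> n; exact: cover_outer_ge0.
pose P n (B : nat -> I) :=
  ((forall k, D (B k)) /\ A n `<=` \bigcup_k S (B k)) /\
  \sum_(k <oo) w (B k) <= cover_outer (A n) + (e%:num / (2 ^ n.+1)%:R)%:E.
have [G PG] : {G : nat -> nat -> I & forall n, P n (G n)}.
  apply: (@choice _ _ P) => n; rewrite /P.
  have fA : cover_outer (A n) \is a fin_num.
    rewrite ge0_fin_numE ?cover_outer_ge0// ltey; apply/eqP; exact: Aoo.
  have en1 : (0 < e%:num / (2 ^ n.+1)%:R)%R by [].
  have /(lb_ereal_inf_adherent en1)[x [B [DB AB] wB] xS] := fA.
  by exists B; split => //; rewrite wB; exact/ltW.
have wG_ge0 x : 0 <= (w \o uncurry G) x.
  by case: x => a b; apply: w_ge0; exact: (PG a).1.1.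
apply: (@le_trans _ _ (\esum_(i in setT) (w \o uncurry G) i)).
  apply: ereal_inf_lbound => /=.
  have /card_esym/ppcard_eqP[f] := card_nat2.
  exists (uncurry G \o f).
    split => [i|].
      by rewrite /= /uncurry; case: (f i) => a b; exact: (PG a).1.1.
    move=> t [i _] /((PG i).1.2)[j _ Bijt]; exists (f^-1%FUN (i, j)) => //=.
    by rewrite invK ?inE.
  rewrite -(esum_pred_image (w \o uncurry G) _ xpredT) ?[fun=> _]set_true//.
  by rewrite image_eq.
rewrite (_ : esum _ _ = \sum_(i <oo) \sum_(j <oo ) w (G i j)); last first.
  pose J : nat -> set (nat * nat) := fun i => [set (i, j) | j in setT].
  rewrite (_ : setT = \bigcup_k J k); last first.
    by rewrite predeqE => -[a b]; split => // _; exists a => //; exists b.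
  rewrite esum_bigcupT /=; last 2 first.
    - apply/trivIsetP => i j _ _ ij.
      rewrite predeqE => -[n m] /=; split => //= -[] [_] _ [<-{n} _].
      by move=> [m' _] [] /esym/eqP; rewrite (negbTE ij).
    - by move=> /= x; exact: wG_ge0.
  rewrite -(image_id [set: nat]) -fun_true esum_pred_image//; last first.
    by move=> n _; apply: esum_ge0 => x _; exact: wG_ge0.
  apply: eq_eseriesr => /= j _.
  rewrite -(esum_pred_image (w \o uncurry G) (pair j) predT)//=; last 2 first.
    by move=> n _; exact: (wG_ge0 (j, n)).
    by move=> ? ? _ _; exact: (@can_inj _ _ _ snd).
  by congr esum; rewrite predeqE => -[a b]; split; move=> [i _ <-]; exists i.
apply: lee_nneseries => [i _ _|i _]; last exact: (PG i).2.
by apply: nneseries_ge0 => m _ _; exact: (wG_ge0 (i, m)).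
Qed.

End cover_outer.

Section lebesgue.
Context (R : realType) (m : nat).
Local Notation V := 'rV[R]_m.+1.

Definition box_index : set (V * V) :=
  [set ab : V * V | forall i, ab.1 ord0 i <= ab.2 ord0 i].

Definition box (ab : V * V) : set V :=
  [set x : V | forall i, ab.1 ord0 i < x ord0 i <= ab.2 ord0 i].

Definition box_volume (ab : V * V) : \bar R :=
  (\prod_(i < m.+1) (ab.2 ord0 i - ab.1 ord0 i))%:E.

Definition lebesgue_outer : set V -> \bar R :=
  cover_outer box_index box box_volume.

Let box_volume_ge0 ab : box_index ab -> (0 <= box_volume ab)%E.
Proof. by move=> abD; rewrite lee_fin prodr_ge0// => i _; rewrite subr_ge0. Qed.

Let lebesgue_outer0 : lebesgue_outer set0 = 0%E.
Proof.
apply: (@cover_outer0 _ _ _ _ _ _ box_volume_ge0 (0, 0)) => [i|] //=.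
by rewrite /box_volume big_ord_recl/= !mxE subrr mul0r.
Qed.

HB.instance Definition _ := isOuterMeasure.Build R V lebesgue_outer
  lebesgue_outer0 (cover_outer_ge0 box box_volume_ge0)
  (@le_cover_outer _ _ _ _ _ _)
  (cover_outer_sigma_subadditive box box_volume_ge0).

Definition lebesgue_rV : set (caratheodory_type lebesgue_outer) -> \bar R :=
  lebesgue_outer.

HB.instance Definition _ := isMeasure.Build _ _ _ lebesgue_rV
  (@caratheodory_measure0 _ _ lebesgue_outer)
  (@caratheodory_measure_ge0 _ _ lebesgue_outer)
  (@caratheodory_measure_sigma_additive _ _ lebesgue_outer).

End lebesgue.
Arguments lebesgue_outer : clear implicits.
Arguments lebesgue_rV : clear implicits.

(* Volume of the Euclidean unit ball of R^d, pi^(d/2) / Gamma(d/2 + 1), through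
   the recursion omega_(d+2) = 2 pi / (d + 2) * omega_d. *)
Fixpoint unit_ball_volume (R : realType) (d : nat) : R :=
  match d with
  | 0 => 1
  | 1 => 2
  | d'.+2 => 2 * pi / d%:R * unit_ball_volume R d'
  end.

Section hausdorff.
Context (R : realType) (d m : nat).
Local Notation V := 'rV[R]_m.
Local Open Scope ereal_scope.

Definition ediam (A : set V) : \bar R :=
  ereal_sup [set (enorm (x.1 - x.2))%:E | x in A `*` A].

(* The case of set0 is singled out because ediam set0 = -oo. The constant
   omega_d / 2 ^ d makes the d-dimensional measure agree with the Lebesgue
   measure on d-dimensional planes. *)
Definition hausdorff_weight (A : set V) : \bar R :=
  if A == set0 then 0
  else (unit_ball_volume R d)%:E * ((2^-1)%:E * ediam A) ^+ d.

Definition hausdorff_delta (delta : R) : set V -> \bar R :=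
  cover_outer [set A | ediam A <= delta%:E] id hausdorff_weight.

Definition hausdorff_outer (A : set V) : \bar R :=
  ereal_sup [set hausdorff_delta delta A |
             delta in [set delta : R | (0 < delta)%R]].

Let unit_ball_volume_ge0 k : (0 <= unit_ball_volume R k)%R.
Proof.
suff: (0 <= unit_ball_volume R k)%R && (0 <= unit_ball_volume R k.+1)%R.
  by case/andP.
elim: k => [|k /andP[k0 k1]]; first by rewrite /= ler01 ler0n.
by rewrite k1/= mulr_ge0// divr_ge0// mulr_ge0// pi_ge0.
Qed.

Let hausdorff_weight_ge0 A : 0 <= hausdorff_weight A.
Proof.
rewrite /hausdorff_weight; case: ifPn => // /set0P[x Ax].
rewrite mule_ge0 ?lee_fin// expe_ge0// mule_ge0 ?lee_fin// ?invr_ge0//.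
apply: (@le_trans _ _ (enorm (x - x))%:E); first by rewrite lee_fin sqrtr_ge0.
by apply: ereal_sup_ubound; exists (x, x).
Qed.

Let weight_ge0 delta (A : set V) : ediam A <= delta%:E ->
  0 <= hausdorff_weight A.
Proof. by move=> _; exact: hausdorff_weight_ge0. Qed.

Let hausdorff_outer_ge0 A : 0 <= hausdorff_outer A.
Proof.
apply: (@le_trans _ _ (hausdorff_delta 1 A)).
  exact: (cover_outer_ge0 id (@weight_ge0 1)).
by apply: ereal_sup_ubound; exists 1%R => //=.
Qed.

Let hausdorff_outer0 : hausdorff_outer set0 = 0.
Proof.
apply/eqP; rewrite eq_le hausdorff_outer_ge0 andbT.
apply: ge_ereal_sup => _ [e e0 <-].
rewrite /hausdorff_delta.
rewrite (@cover_outer0 _ _ _ _ _ _ (@weight_ge0 e) set0)//.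
  by rewrite /= /ediam setX0 image_set0 ereal_sup0 leNye.
by rewrite /hausdorff_weight eqxx.
Qed.

Let le_hausdorff_outer : {homo hausdorff_outer : A B / A `<=` B >-> A <= B}.
Proof.
move=> A B AB; apply: ge_ereal_sup => _ [e e0 <-].
apply: le_ereal_sup_tmp; exists (hausdorff_delta e B); first by exists e.
exact: le_cover_outer.
Qed.

Let hausdorff_outer_sigma_subadditive : sigma_subadditive hausdorff_outer.
Proof.
move=> F; apply: ge_ereal_sup => _ [e e0 <-].
apply: le_trans (cover_outer_sigma_subadditive id (@weight_ge0 e) F) _.
apply: lee_nneseries => [i _ _|i _].
  exact: (cover_outer_ge0 id (@weight_ge0 e)).
by apply: ereal_sup_ubound; exists e.
Qed.

HB.instance Definition _ := isOuterMeasure.Build R V hausdorff_outer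
  hausdorff_outer0 hausdorff_outer_ge0 le_hausdorff_outer
  hausdorff_outer_sigma_subadditive.

Definition hausdorff : set (caratheodory_type hausdorff_outer) -> \bar R :=
  hausdorff_outer.

HB.instance Definition _ := isMeasure.Build _ _ _ hausdorff
  (@caratheodory_measure0 _ _ hausdorff_outer)
  (@caratheodory_measure_ge0 _ _ hausdorff_outer)
  (@caratheodory_measure_sigma_additive _ _ hausdorff_outer).

End hausdorff.
Arguments hausdorff_outer : clear implicits.
Arguments hausdorff : clear implicits.

(* The principal value is the limit, as eps tends to 0 from the right, of the
   integral over the complement of the Euclidean ball of radius eps at x. *)
Definition nonlocal_mean_curvature (R : realType) (n : nat) (alpha : R)
    (Omega : set 'rV[R]_n.+1) (x : 'rV[R]_n.+1) : \bar R :=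
  ((alpha / 2)%:E *
   lim ((\int[lebesgue_rV R n]_(y in [set y | (eps <= enorm (y - x))%R])
          ((\1_(~` Omega) y - \1_Omega y) /
           (enorm (y - x)) `^ (n.+1%:R + alpha))%:E) @[eps --> 0^'+]))%E.

(* Main.v *)
From HB Require Import structures.
Require Import Defs.
From mathcomp Require Import all_boot all_order all_algebra.
From mathcomp Require Import all_classical all_reals all_analysis.
From mathcomp Require Import measurable_realfun ring lra.
Set Implicit Arguments.
Unset Strict Implicit.
Unset Printing Implicit Defensive.
Import Order.TTheory GRing.Theory Num.Theory.
Import numFieldNormedType.Exports.

Local Open Scope classical_set_scope.
Local Open Scope ring_scope.

(** The inequality is proved at every point x of E. Put r = c |E|^(1/n) and look
    at Omega in the cube of half-side 6 r about x. Two facts follow from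
    convexity and from x not being in Omega. Some closed orthant with vertex x
    misses Omega: a convex set that meets every closed orthant at x contains x
    ([convex_meets_orthants]). And if y is in Omega, then its reflection 2 x - y
    is not, since x is their midpoint.

    Normalize the signs of the coordinates so that the orthant free of Omega
    is the positive one, and test 2 ^ n cubes of side r lying in the negative
    orthant, one for each sign pattern of the coordinates z_j - z_0
    (j = 1, ..., n), which are the coordinates along the diagonal projection
    ([exterior_box_or_wide_boundary]).

    - If one of these cubes misses Omega, its reflection through x, which lies
      in the free orthant, misses Omega as well. Reflecting through x shows
      that the truncated integrals defining H_alpha(x) equal the integral of
      |y - x|^-(n+1+alpha) over the points y such that neither y nor 2 x - y is
      in Omega ([curvature_integral_truncated]); so the principal value is a
      monotone limit, and the cube alone gives H_alpha(x) >= c r^-alpha.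

    - If all of them meet Omega, convexity fills in the projection: every
      point of the n-dimensional cube of half-side r is the projection of a
      point of Omega in the negative orthant. The diagonal through that point
      ends in the free orthant, so it crosses the boundary. Hence the part of
      the boundary within distance C r of x projects onto an n-cube and its
      n-dimensional measure is at least c r^n = 2 |E|, by the choice of r. At
      least |E| of it lies outside E, and the boundary integral is at least
      c |E| r^-(n+sp).

    Either way the right-hand side is at least c |E|^-(sp/n).

    The measures come from outer measures, so their basic properties have to
    be established: the volume of boxes ([cover_volume_le]), invariance under
    point reflections ([lebesgue_outer_reflect]), measurability of half-spaces
    and from it of all open sets ([open_caratheodory]), and the comparison of
    the Hausdorff measure with the Lebesgue measure of a Lipschitz image
    ([hausdorff_outer_ge_of_covers_cube]). *)

(** * Convex sets and orthants *)

Section convexity.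
Context (R : realType).

Lemma convex_set_comb (V : lmodType R) (K : set V) (a b : V) (t : R) :
  convex_set K -> 0 <= t <= 1 -> K a -> K b -> K (t *: a + (1 - t) *: b).
Proof.
move=> cK /andP[t0 t1] Ka Kb.
pose l : {i01 R} := Itv01 t0 t1.
have := cK a b l; rewrite !inE => /(_ Ka Kb).
by rewrite /conv /=.
Qed.

(** The coordinates of p - w are made zero one at a time: two points of K whose
    k-th coordinates lie on opposite sides of w have a convex combination whose
    k-th coordinate is that of w, and the combination keeps the signs that the
    two points share in the other coordinates. *)
Lemma convex_meets_orthants (n : nat) (K : set 'rV[R]_n) (w : 'rV[R]_n) :
  (forall a b t, 0 <= t <= 1 -> K a -> K b -> K (t *: a + (1 - t) *: b)) ->
  (forall v : 'I_n -> bool, exists2 p, K p &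
     forall j, 0 <= (-1) ^+ v j * (p ord0 j - w ord0 j)) ->
  K w.
Proof.
move=> cK meet.
suff /(_ n (leqnn n) (fun=> false)) [p Kp [pw _]] : forall k, (k <= n)%N ->
    forall v : 'I_n -> bool, exists2 p, K p &
    (forall j : 'I_n, (j < k)%N -> p ord0 j = w ord0 j) /\
    (forall j : 'I_n, (k <= j)%N -> 0 <= (-1) ^+ v j * (p ord0 j - w ord0 j)).
  have <- // : p = w.
  by apply/rowP => j; exact: pw.
elim=> [_ v|k IH kn v].
  by have [p Kp pv] := meet v; exists p => //; split.
pose k0 := Ordinal kn.
have [p Kp [pw pv]] := IH (ltnW kn) (fun j => if j == k0 then false else v j).
have [q Kq [qw qv]] := IH (ltnW kn) (fun j => if j == k0 then true else v j).
have pk : 0 <= p ord0 k0 - w ord0 k0.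
  by have := pv k0 (leqnn k); rewrite eqxx expr0 mul1r.
have qk : 0 <= w ord0 k0 - q ord0 k0.
  by have := qv k0 (leqnn k); rewrite eqxx expr1 mulN1r opprB.
have sgn_rest (j : 'I_n) : (k < j)%N -> (j == k0) = false.
  by move=> kj; apply/negbTE; apply: contraTneq kj => ->; rewrite ltnn.
have [pwk|pwk] := eqVneq (p ord0 k0) (w ord0 k0).
  exists p => //; split => j.
    rewrite ltnS leq_eqVlt => /orP[/eqP jk|/pw//].
    by rewrite (_ : j = k0)//; apply/val_inj.
  by move=> kj; have := pv j (ltnW kj); rewrite sgn_rest.
pose s := p ord0 k0 - q ord0 k0.
have s0 : 0 < s.
  rewrite /s lt_def; apply/andP; split; last by lra.
  apply/eqP => pq; move/eqP: pwk; apply; lra.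
pose t := (w ord0 k0 - q ord0 k0) / s.
have t01 : 0 <= t <= 1.
  by rewrite /t divr_ge0 ?(ltW s0)//= ler_pdivrMr// mul1r /s; lra.
exists (t *: p + (1 - t) *: q); first exact: cK.
split=> j.
  rewrite ltnS leq_eqVlt !mxE => /orP[/eqP jk|jk].
    rewrite (_ : j = k0); last exact/val_inj.
    by rewrite /t /s; field; rewrite -/s gt_eqF.
  by rewrite pw// qw//; ring.
move=> kj; rewrite !mxE.
have := pv j (ltnW kj); have := qv j (ltnW kj); rewrite sgn_rest//.
move=> Q P.
have -> : (-1) ^+ v j * (t * p ord0 j + (1 - t) * q ord0 j - w ord0 j) =
  t * ((-1) ^+ v j * (p ord0 j - w ord0 j)) +
  (1 - t) * ((-1) ^+ v j * (q ord0 j - w ord0 j)) by ring.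
by case/andP: t01 => t0 t1; rewrite addr_ge0// mulr_ge0//; lra.
Qed.

(** Let t be the supremum of the parameters whose point is in A. The point at t
    is in the closure of A, and it is not in the open set A: otherwise the
    segment would stay in A a little longer. *)
Lemma segment_meets_boundary (V : normedModType R) (A : set V) (a b : V) :
  open A -> A a -> ~ A b ->
  exists2 t : R, 0 <= t <= 1 & boundary A (a + t *: (b - a)).
Proof.
move=> oA Aa Ab.
pose f (t : R) := a + t *: (b - a).
have cf : continuous f.
  move=> t; apply: cvgD; first exact: cvg_cst.
  by apply: cvgZr_tmp; exact: cvg_id.
have oU : open (f @^-1` A) by apply: open_comp => // t _; exact: cf.
pose S := [set t : R | 0 <= t <= 1 /\ A (f t)].
have S0 : S 0 by split; rewrite ?lexx ?ler01// /f scale0r addr0.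
have hS : has_sup S.
  by split; [exists 0|exists 1 => t [/andP[]]].
pose t := sup S.
have t0 : 0 <= t by exact: ub_le_sup hS.2 _ S0.
have t1 : t <= 1 by apply: ge_sup => [|z [/andP[]]//]; exists 0.
exists t; first by rewrite t0.
split.
- move=> B /cf [e /= e0 fB].
  have [s Ss ts] := sup_adherent e0 hS.
  exists (f s); split; first by case: Ss.
  apply: fB => /=.
  have st : s <= t by exact: ub_le_sup hS.2 _ Ss.
  by rewrite ger0_norm ?subr_ge0//; rewrite -/t in ts; lra.
- move=> /interior_subset Aft.
  have [e /= e0 fA] : nbhs t (f @^-1` A) by exact: open_nbhs_nbhs.
  have [tlt1|tge1] := ltP t 1; last first.
    by apply: Ab; have -> : b = f t; rewrite // /f (_ : t = 1) ?scale1r ?subrKC//; lra.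
  pose s := Num.min 1 (t + e / 2).
  have ts : t < s by rewrite lt_min tlt1 ltrDl divr_gt0.
  suff : s <= t by lra.
  apply: ub_le_sup hS.2 _ _.
  split; first by rewrite ge_min lexx andbT; lra.
  apply: fA => /=; rewrite ltr0_norm ?subr_lt0// opprB.
  by rewrite ltrBlDl gt_min; apply/orP; right; lra.
Qed.

(** The dichotomy at scale r. In the first case, a is the corner of a cube of
    side r that misses Omega together with its reflection through x. In the
    second one, v gives the signs of an orthant at x free of Omega, and the
    boundary near x projects along the diagonal of this orthant onto a cube of
    half-side r. *)
Lemma exterior_box_or_wide_boundary (n : nat) (Omega : set 'rV[R]_n.+1)
    (x : 'rV[R]_n.+1) (r : R) :
  open Omega -> convex_set Omega -> ~ Omega x -> 0 < r ->
  (exists a : 'rV[R]_n.+1, forall y : 'rV[R]_n.+1,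
     (forall i, a ord0 i <= y ord0 i <= a ord0 i + r) ->
     [/\ ~ Omega y, ~ Omega (2 *: x - y) &
         forall i, r <= `|y ord0 i - x ord0 i| <= 6 * r]) \/
  (exists v : 'I_n.+1 -> bool, forall w : 'rV[R]_n,
     (forall j, `|w ord0 j| <= r) ->
     exists2 y, boundary Omega y &
       (forall i, `|y ord0 i - x ord0 i| <= 6 * r) /\
       forall j, (-1) ^+ v (lift ord0 j) * (y - x) ord0 (lift ord0 j) -
                 (-1) ^+ v ord0 * (y - x) ord0 ord0 = w ord0 j).
Proof.
move=> oO cO xO r0.
have cOt a b t := @convex_set_comb _ Omega a b t cO.
have [v vO] : exists v : 'I_n.+1 -> bool, forall y, Omega y ->
    ~ forall i, 0 <= (-1) ^+ v i * (y ord0 i - x ord0 i).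
  apply: contrapT => /forallNP noV; apply: xO.
  apply: convex_meets_orthants => // v.
  have /existsNP[y /not_implyP[Oy /contrapT yv]] := noV v.
  by exists y.
(* In the coordinates with signs v, the cube B u has its corner at c u. The
   coordinate 0 runs through [-4 r, -3 r] and the others through [-2 r, -r] or
   [-6 r, -5 r], so that the difference with the coordinate 0 has the sign
   prescribed by u and absolute value at least r. *)
pose c (u : 'I_n -> bool) (i : 'I_n.+1) : R :=
  if unlift ord0 i is Some j then (if u j then - 6 * r else - 2 * r)
  else - 4 * r.
have cle u i : - 6 * r <= c u i /\ c u i <= - 2 * r.
  by rewrite /c; case: unlift => [j|]; [case: (u j)|]; split; lra.
pose B u := [set y : 'rV[R]_n.+1 | forall i,
  c u i <= (-1) ^+ v i * (y ord0 i - x ord0 i) <= c u i + r].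
have [[u uB]|nB] := pselect (exists u, forall y, B u y -> ~ Omega y).
  left; exists (\row_i (x ord0 i + (if v i then - (c u i + r) else c u i))).
  move=> y yB.
  have By : B u y.
    by move=> i; have := yB i; rewrite !mxE; case: (v i);
      rewrite ?expr0 ?expr1; lra.
  split; first exact: uB.
    move=> Oy; apply: (vO _ Oy) => i; rewrite !mxE.
    by have := By i; have := cle u i; case: (v i); rewrite ?expr0 ?expr1; lra.
  move=> i; have := By i; have := cle u i; case: (v i) => -[c1 c2].
    by rewrite expr1 => h; rewrite ger0_norm; lra.
  by rewrite expr0 => h; rewrite ler0_norm; lra.
right; exists v => w wr.
pose K := [set w : 'rV[R]_n | exists2 z, Omega z &
  (forall i, - 6 * r <= (-1) ^+ v i * (z ord0 i - x ord0 i) <= - r) /\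
  (forall j, (-1) ^+ v (lift ord0 j) * (z - x) ord0 (lift ord0 j) -
             (-1) ^+ v ord0 * (z - x) ord0 ord0 = w ord0 j)].
have [z Oz [zr zw]] : K w.
  apply: convex_meets_orthants => [a b t t01 [y Oy [yr ya]] [z Oz [zr zb]]|u].
    exists (t *: y + (1 - t) *: z); first exact: cOt.
    split=> [i|j]; last by rewrite !mxE -ya -zb !mxE; ring.
    have := yr i; have := zr i; rewrite !mxE.
    set Y := _ * (_ - _); set Z := _ * (_ - _).
    move=> h1 h2.
    have -> : (-1) ^+ v i * (t * y ord0 i + (1 - t) * z ord0 i - x ord0 i) =
      t * Z + (1 - t) * Y by rewrite /Y /Z; ring.
    by apply/andP; split; nra.
  have /forallNP/(_ u)/existsNP[y /not_implyP[By /contrapT Oy]] := nB.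
  exists (\row_j ((-1) ^+ v (lift ord0 j) * (y - x) ord0 (lift ord0 j) -
             (-1) ^+ v ord0 * (y - x) ord0 ord0)).
    exists y => //; split=> [i|j]; last by rewrite [RHS]mxE.
    by have := By i; have := cle u i; lra.
  move=> j; rewrite !mxE.
  have := By (lift ord0 j); have := By ord0.
  rewrite /c unlift_none liftK.
  have := wr j; rewrite ler_norml.
  by case: (u j); rewrite ?expr0 ?expr1; lra.
(* Moving by 6 r along the diagonal leads from the negative orthant to the
   orthant free of Omega and does not change the projection. *)
pose e : 'rV[R]_n.+1 := \row_i ((-1) ^+ v i).
have Oze : ~ Omega (z + (6 * r) *: e).
  move=> /vO; apply=> i; rewrite !mxE.
  by have := zr i; case: (v i); rewrite ?expr0 ?expr1; lra.
have [t t01] := segment_meets_boundary oO Oz Oze.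
rewrite addrAC subrr add0r scalerA => bt.
exists (z + (t * (6 * r)) *: e) => //; split => [i|j].
  have vz : `|z ord0 i + t * (6 * r) * (-1) ^+ v i - x ord0 i| =
            `|(-1) ^+ v i * (z ord0 i - x ord0 i) + t * (6 * r)|.
    rewrite -[LHS]mul1r -[X in X * _ = _](normr_sign R (v i)) -normrM; congr `|_|.
    by case: (v i); rewrite ?expr0 ?expr1; ring.
  by rewrite !mxE vz ler_norml; have := zr i; case/andP : t01 => t0 t1; nra.
rewrite -zw !mxE; case: (v ord0); case: (v (lift ord0 j)).
- by rewrite expr1; ring.
- by rewrite expr0 expr1; ring.
- by rewrite expr0 expr1; ring.
- by rewrite expr0; ring.
Qed.

End convexity.

(** * Lebesgue outer measure of boxes *)

Section volume.
Context (R : realType).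

(** Volume is subadditive on countable covers of a box by boxes. Induction on
    the dimension: for each value t of the first coordinate, the slices of the
    boxes whose first side contains t cover the slice of the given box, and
    integrating the resulting inequality in t gives the claim. The boolean
    weights J select these boxes. *)
Lemma cover_volume_le (m : nat) (J : nat -> bool) (A B : nat -> 'I_m -> R)
    (a b : 'I_m -> R) :
  (forall k i, A k i <= B k i) -> (forall i, a i <= b i) ->
  (forall x : 'I_m -> R, (forall i, a i < x i <= b i) ->
     exists2 k, J k & forall i, A k i < x i <= B k i) ->
  ((\prod_i (b i - a i))%:E <=
   \sum_(k <oo) ((J k)%:R * \prod_i (B k i - A k i))%:E)%E.
Proof.
elim: m J A B a b => [|m IH] J A B a b AB ab cov.
  have [k Jk _] : exists2 k, J k & forall i : 'I_0, A k i < 0 <= B k i.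
    by apply: (cov (fun=> 0)) => -[].
  rewrite big_ord0; apply: le_trans (nneseries_lim_ge k.+1 _); last first.
    by move=> i _ _; rewrite lee_fin big_ord0 mulr1.
  rewrite big_nat_recr//= big_ord0 mulr1 Jk leeDr// sume_ge0// => i _.
  by rewrite lee_fin big_ord0 mulr1.
pose D : set R := `]a ord0, b ord0]%classic.
pose I k : set R := `]A k ord0, B k ord0]%classic.
pose P := \prod_(i < m) (b (lift ord0 i) - a (lift ord0 i)).
pose Q k := \prod_(i < m) (B k (lift ord0 i) - A k (lift ord0 i)).
have P0 : 0 <= P by rewrite prodr_ge0// => i _; rewrite subr_ge0.
have Q0 k : 0 <= Q k by rewrite prodr_ge0// => i _; rewrite subr_ge0.
have mD : measurable D by exact: measurable_itv.
have mI k : measurable (I k) by exact: measurable_itv.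
have muitv (c d : R) : c <= d -> lebesgue_measure `]c, d]%classic = (d - c)%:E.
  move=> cd; rewrite lebesgue_measure_itv/= lte_fin.
  by case: ltP => // dc; rewrite (_ : d = c) ?subrr//; apply/eqP; rewrite eq_le dc.
have slice t : D t ->
    (P%:E <= \sum_(k <oo) (((J k)%:R * Q k)%:E * (\1_(I k) t)%:E))%E.
  move=> Dt.
  have JI k : (((J k)%:R * Q k)%:E * (\1_(I k) t)%:E =
               ((J k && (t \in I k))%:R * Q k)%:E)%E.
    by rewrite -EFinM indicE mulrAC -natrM mulnb.
  under eq_eseriesr do rewrite JI.
  apply: IH => // x abx.
  pose X i := if unlift ord0 i is Some j then x j else t.
  have [i|k Jk kX] := cov X.
    rewrite /X; case: unliftP => [j ->//|->].
    by move: Dt; rewrite /D /= in_itv.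
  exists k => [|i]; last by have := kX (lift ord0 i); rewrite /X liftK.
  rewrite Jk /= inE /I /= in_itv /=.
  by have := kX ord0; rewrite /X unlift_none.
rewrite big_ord_recl -/P.
have -> : ((b ord0 - a ord0) * P)%:E = (\int[lebesgue_measure]_(t in D) P%:E)%E.
  by rewrite integral_cst// [X in (_ * X)%E]muitv// -EFinM mulrC.
pose f k t := (((J k)%:R * Q k)%:E * (\1_(I k) t)%:E)%E : \bar R.
have f0 k t : (0 <= f k t)%E by rewrite mule_ge0// lee_fin mulr_ge0.
have mf k : measurable_fun D (f k).
  by apply: measurable_funeM; apply/measurable_EFinP; exact: measurable_indic.
apply: (@le_trans _ _ (\int[lebesgue_measure]_(t in D) (\sum_(k <oo) f k t))%E).
  apply: ge0_le_integral => //.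
  by have := @ge0_emeasurable_sum _ _ _ D f xpredT (fun k x _ _ => f0 k x) (fun k _ => mf k).
rewrite integral_nneseries//.
apply: lee_nneseries => [k _ _|k _]; first exact: integral_ge0.
rewrite /f ge0_integralZl_EFin ?mulr_ge0//; last first.
  by apply/measurable_EFinP; apply: measurable_indic; exact: mI.
rewrite integral_indic; [|exact: mD|exact: mI].
rewrite big_ord_recl -/(Q k).
have -> : ((J k)%:R * ((B k ord0 - A k ord0) * Q k))%:E =
    (((J k)%:R * Q k)%:E * lebesgue_measure `]A k ord0, B k ord0]%classic)%E.
  by rewrite muitv// -EFinM; congr (_%:E); ring.
apply: lee_pmul; rewrite ?lee_fin ?mulr_ge0//.
apply: le_measure; rewrite ?inE; last exact: subIsetl.
  by apply: measurableI; [exact: mI|exact: mD].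
exact: mI.
Qed.

End volume.

Section lebesgue_outer_theory.
Context (R : realType) (m : nat).
Local Notation V := 'rV[R]_m.+1.
Implicit Types (a b x : V) (X : set V).

Lemma box_volume_ge0 (ab : V * V) : box_index ab -> (0 <= box_volume ab)%E.
Proof.
by move=> abD; rewrite lee_fin prodr_ge0// => i _; rewrite subr_ge0.
Qed.

Lemma lebesgue_outer_box_ge (ab : V * V) :
  box_index ab -> (box_volume ab <= lebesgue_outer R m (box ab))%E.
Proof.
move=> abD; apply: le_ereal_inf_tmp => _ [F [DF boxF] <-].
have -> : (\sum_(k <oo) box_volume (F k) = \sum_(k <oo)
    ((true)%:R * \prod_i ((F k).2 ord0 i - (F k).1 ord0 i))%:E)%E.
  by apply: eq_eseriesr => k _; rewrite mul1r.
apply: (@cover_volume_le R m.+1 (fun=> true)) => // y aby.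
have [k _ Fky] : (\bigcup_k box (F k)) (\row_i y i).
  by apply: boxF => i; rewrite mxE.
by exists k => [|i]; [|have := Fky i; rewrite mxE].
Qed.

Lemma lebesgue_outer_le_box (ab : V * V) X :
  box_index ab -> X `<=` box ab -> (lebesgue_outer R m X <= box_volume ab)%E.
Proof.
move=> abD Xab.
pose F k : V * V := if k is 0 then ab else (0, 0).
have vol0 : box_volume (0 : V, 0 : V) = 0%E.
  by rewrite /box_volume big_ord_recl/= !mxE subrr mul0r.
have -> : box_volume ab = (\sum_(k <oo) box_volume (F k))%E.
  have F0 k : (0 <= box_volume (F k))%E.
    by case: k => [|k]; [exact: box_volume_ge0|rewrite vol0].
  by rewrite nneseries_recl// eseries0 ?adde0// => -[|k].
apply: ereal_inf_lbound; exists F => //; split.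
  by move=> [|k]//= i; rewrite mxE.
by move=> y /Xab aby; exists 0%N.
Qed.

(** A closed box is contained in half-open boxes that are larger by e in each
    direction; the volume of these is a polynomial in e, hence continuous. *)
Lemma lebesgue_outer_closed_box_le a b : (forall i, a ord0 i <= b ord0 i) ->
  (lebesgue_outer R m [set y | forall i, (a ord0 i <= y ord0 i <= b ord0 i)%R]
   <= (\prod_i (b ord0 i - a ord0 i))%:E)%E.
Proof.
move=> ab; set X := [set y | _].
pose p : {poly R} := \prod_(i < m.+1) ('X + (b ord0 i - a ord0 i)%:P).
have pE e : p.[e] = \prod_(i < m.+1) (e + (b ord0 i - a ord0 i)).
  by rewrite horner_prod; apply: eq_bigr => i _; rewrite !hornerE.
have -> : \prod_i (b ord0 i - a ord0 i) = p.[0].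
  by rewrite pE; apply: eq_bigr => i _; rewrite add0r.
have p_cvg : (fun e => (p.[e])%:E) @ 0^'+ --> (p.[0])%:E.
  apply: cvg_EFin; first by near=> e.
  by apply: cvg_at_right_filter; exact: continuous_horner.
apply: (cvge_to_ge p_cvg); near=> e.
have e0 : 0 < e by [].
pose a' : V := \row_i (a ord0 i - e).
have -> : (p.[e])%:E = box_volume (a', b).
  by rewrite pE; congr (_%:E); apply: eq_bigr => i _ /=; rewrite mxE; ring.
apply: lebesgue_outer_le_box => [i|y yab i] /=; rewrite mxE.
  by have := ab i; lra.
by have := yab i; lra.
Unshelve. all: by end_near. Qed.

(** A reflected half-open box is open on the wrong side, but it is contained in
    the closed box with the same volume. *)
Lemma lebesgue_outer_reflect x X :
  lebesgue_outer R m [set y | X (2 *: x - y)] = lebesgue_outer R m X.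
Proof.
suff refl_le (Y : set V) : (lebesgue_outer R m [set y | Y (2 *: x - y)%R] <=
                  lebesgue_outer R m Y)%E.
  apply/eqP; rewrite eq_le refl_le/=.
  have := refl_le [set y | X (2 *: x - y)]; congr (_ <= _)%E.
  by congr (lebesgue_outer R m); apply/funext => y /=; rewrite subKr.
apply: le_ereal_inf_tmp => _ [F [DF YF] <-].
pose C k := [set y : V | forall i,
  ((2 *: x - (F k).2) ord0 i <= y ord0 i <= (2 *: x - (F k).1) ord0 i)%R].
apply: (@le_trans _ _ (lebesgue_outer R m (\bigcup_k C k))).
  apply: le_outer_measure => y /= /YF [k _ Fk]; exists k => // i.
  by have := Fk i; rewrite !mxE; lra.
apply: le_trans (outer_measure_sigma_subadditive _ _) _.
apply: lee_nneseries => [k _ _|k _]; first exact: outer_measure_ge0.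
apply: le_trans (lebesgue_outer_closed_box_le _) _.
  by move=> i; have := DF k i; rewrite !mxE; lra.
rewrite /box_volume lee_fin le_eqVlt; apply/orP; left; apply/eqP.
by apply: eq_bigr => i _; rewrite !mxE; ring.
Qed.

(** A half-space cuts each box of a cover into two boxes, and the volumes add
    up. *)
Lemma lebesgue_outer_half_space (i : 'I_m.+1) (c : R) :
  (lebesgue_outer R m).-caratheodory [set y : V | y ord0 i <= c].
Proof.
apply: le_caratheodory_measurable => X.
apply: le_ereal_inf_tmp => _ [F [DF XF] <-].
(* Clamping c to the i-th side of the box keeps the order of the corners when
   the hyperplane misses the box. *)
pose cut k := Num.max ((F k).1 ord0 i) (Num.min ((F k).2 ord0 i) c).
pose F1 k : V * V := ((F k).1, \row_j (if j == i then cut k else (F k).2 ord0 j)).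
pose F2 k : V * V := (\row_j (if j == i then cut k else (F k).1 ord0 j), (F k).2).
have cut_ge k : (F k).1 ord0 i <= cut k by rewrite le_max lexx.
have cut_le k : cut k <= (F k).2 ord0 i.
  by rewrite ge_max DF/= ge_min lexx.
have D1 k : box_index (F1 k).
  by move=> j; rewrite /= mxE; case: eqP => [->//|_]; exact: DF.
have D2 k : box_index (F2 k).
  by move=> j; rewrite /= mxE; case: eqP => [->//|_]; exact: DF.
have vol k : (box_volume (F k) = box_volume (F1 k) + box_volume (F2 k))%E.
  rewrite /box_volume -EFinD; congr (_%:E).
  rewrite (bigD1 i)//= [X in _ = X + _](bigD1 i)//= [X in _ = _ + X](bigD1 i)//=.
  rewrite !mxE eqxx.
  have -> : \prod_(j < m.+1 | j != i) ((F1 k).2 ord0 j - (F k).1 ord0 j) =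
            \prod_(j < m.+1 | j != i) ((F k).2 ord0 j - (F k).1 ord0 j).
    by apply: eq_bigr => j /negbTE ji; rewrite mxE ji.
  have -> : \prod_(j < m.+1 | j != i) ((F k).2 ord0 j - (F2 k).1 ord0 j) =
            \prod_(j < m.+1 | j != i) ((F k).2 ord0 j - (F k).1 ord0 j).
    by apply: eq_bigr => j /negbTE ji; rewrite mxE ji.
  by ring.
under eq_eseriesr do rewrite vol.
rewrite nneseriesD; [|by move=> k _ _; exact: box_volume_ge0..].
apply: leeD; apply: ereal_inf_lbound.
  exists F1 => //; split => // y [/XF[k _ Fky] yc]; exists k => // j.
  have := Fky j; rewrite /= mxE; case: eqP => [->|//] /andP[-> yb] /=.
  by rewrite le_max le_min yb yc orbT.
exists F2 => //; split => // y [/XF[k _ Fky] /negP]; rewrite -ltNge => cy.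
exists k => // j.
have := Fky j; rewrite /= mxE; case: eqP => [->|//] /andP[ay ->]; rewrite andbT.
by rewrite gt_max ay gt_min cy orbT.
Qed.

End lebesgue_outer_theory.

(** * Borel sets and the Euclidean norm *)

Section borel.
Context (R : realType) (m : nat) (mu : {outer_measure set 'rV[R]_m -> \bar R}).
Local Notation V := 'rV[R]_m.
Hypothesis half_space : forall (i : 'I_m) (c : R),
  mu.-caratheodory [set y : V | y ord0 i <= c].

(** An open set is a countable union of half-open boxes with rational corners,
    which are finite intersections of half-spaces and their complements. *)
Lemma open_caratheodory (U : set V) : open U -> mu.-caratheodory U.
Proof.
move=> oU.
pose T := caratheodory_type mu.
pose rbox (f : {ffun 'I_m -> rat * rat}) : set T :=
  \bigcap_(i in [set: 'I_m]) ([set y : T | (y : V) ord0 i <= ratr (f i).2] `\`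
                      [set y : T | (y : V) ord0 i <= ratr (f i).1]).
have mbox f : measurable (rbox f).
  apply: fin_bigcap_measurable => [|i _]; first exact: finite_finset.
  by apply: measurableD; exact: half_space.
pose G k : set T := if unpickle k is Some f then
  (if `[< rbox f `<=` U >] then rbox f else set0) else set0.
suff -> : U = \bigcup_k G k :> set T.
  apply: (@bigcupT_measurable _ T) => k; rewrite /G.
  by case: unpickle => [f|//]; case: ifP.
apply/seteqP; split=> [x Ux|x [k _]]; last first.
  by rewrite /G; case: unpickle => [f|//]; case: asboolP => [fU /fU|].
have /nbhs_ballP[e /= e0 xeU] : nbhs (x : V) U by exact: open_nbhs_nbhs.
have /choice[q qx] : forall i : 'I_m, exists q : rat * rat,
    (x : V) ord0 i - e < ratr q.1 < (x : V) ord0 i /\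
    (x : V) ord0 i < ratr q.2 < (x : V) ord0 i + e.
  move=> i.
  have lt1 : (x : V) ord0 i - e < (x : V) ord0 i by rewrite ltrBlDr ltrDl.
  have lt2 : (x : V) ord0 i < (x : V) ord0 i + e by rewrite ltrDl.
  have [p] := rat_in_itvoo lt1; have [q] := rat_in_itvoo lt2.
  by rewrite !in_itv /= => ? ?; exists (p, q).
pose f : {ffun 'I_m -> rat * rat} := [ffun i => q i].
exists (pickle f) => //; rewrite /G pickleK.
case: asboolP => [_ i _|].
  by have := qx i; rewrite /= !ffunE => -[/andP[_ h1] /andP[h2 _]];
    split => /=; [exact: ltW|apply/negP; rewrite -ltNge].
case=> y yf; apply: xeU; split => // i j; rewrite [i]ord1.
have [] := yf j I; rewrite /= !ffunE => h1 /negP; rewrite -ltNge => h2.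
have [/andP[h3 h4] /andP[h5 h6]] := qx j.
by rewrite /ball/= ltr_norml; apply/andP; split; lra.
Qed.

Lemma closed_caratheodory (F : set V) : closed F -> mu.-caratheodory F.
Proof.
move=> cF; rewrite -(setCK F).
by apply: caratheodory_measurable_setC; apply: open_caratheodory; rewrite openC.
Qed.

Lemma continuous_caratheodory (D : set (caratheodory_type mu)) (f : V -> R) :
  continuous f -> measurable_fun D (f : caratheodory_type mu -> R).
Proof.
move=> cf mD.
apply: (measurability _ (RGenOpens.measurableE R)) => //.
move=> _ [_ [a [b ->]] <-]; apply: measurableI => //.
apply: open_caratheodory; apply: open_comp => [x _|]; first exact: cf.
exact: interval_open.
Qed.

End borel.

Section enorm_theory.
Context (R : realType) (m : nat).
Local Notation V := 'rV[R]_m.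
Implicit Types x y : V.

Lemma enorm_ge0 x : 0 <= enorm x.
Proof. exact: sqrtr_ge0. Qed.

Lemma enormN x : enorm (- x) = enorm x.
Proof.
by congr Num.sqrt; apply: eq_bigr => i _; rewrite mxE sqrrN.
Qed.

Lemma normr_coord_le_enorm x i : `|x ord0 i| <= enorm x.
Proof.
rewrite -sqrtr_sqr ler_wsqrtr// (bigD1 i)//= lerDl.
by apply: sumr_ge0 => j _; exact: sqr_ge0.
Qed.

Lemma enorm_le_cube x (r : R) : (forall i, `|x ord0 i| <= r) ->
  enorm x <= m%:R * r.
Proof.
move=> xr.
have -> : m%:R * r = Num.sqrt ((m%:R * r) ^+ 2).
  rewrite sqrtr_sqr ger0_norm//; case: m x xr => [|k] x xr; first by rewrite mul0r.
  by rewrite mulr_ge0//; exact: le_trans (xr ord0).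
rewrite ler_wsqrtr// exprMn; apply: (@le_trans _ _ (\sum_(i < m) r ^+ 2)).
  by apply: ler_sum => i _; rewrite -real_normK ?num_real// lerXn2r// ?nnegrE//;
    exact: le_trans (xr i).
rewrite sumr_const card_ord -[leLHS]mulr_natl ler_wpM2r ?sqr_ge0//.
by rewrite -natrX ler_nat; case: m {x xr} => // k; rewrite leq_pmulr.
Qed.

Lemma enorm_gt0 x : x != 0 -> 0 < enorm x.
Proof.
move=> /eqP x0; rewrite lt_def enorm_ge0 andbT; apply/eqP => nx.
apply: x0; apply/rowP => i; rewrite mxE; apply/eqP.
by rewrite -normr_le0 -nx normr_coord_le_enorm.
Qed.

Lemma continuous_enormB x : continuous (fun y : V => enorm (y - x)).
Proof.
pose g i (y : V) : R := y ord0 i - x ord0 i.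
have -> : (fun y : V => enorm (y - x)) =
          Num.sqrt \o (fun y : V => \sum_(i < m) g i y * g i y).
  apply/funext => y /=; congr Num.sqrt; apply: eq_bigr => i _.
  by rewrite !mxE expr2.
have cg i : continuous (g i).
  by move=> y; apply: continuousB; [exact: coord_continuous|exact: cst_continuous].
move=> y; apply: continuous_comp; last exact: sqrt_continuous.
move: y; apply: continuous_big => [|i _]; first exact: add_continuous.
by move=> y; apply: continuousM; exact: cg.
Qed.

End enorm_theory.

Lemma closed_cube (R : realType) (m : nat) (a b : 'I_m -> R) :
  closed [set y : 'rV[R]_m | forall i, a i <= y ord0 i <= b i].
Proof.
have -> : [set y : 'rV[R]_m | forall i, a i <= y ord0 i <= b i] =
    \bigcap_(i in [set: 'I_m]) (fun y : 'rV[R]_m => y ord0 i) @^-1` `[a i, b i]%classic.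
  apply/seteqP; split => y h i; first by move=> _; rewrite /= in_itv/=; exact: h.
  by have := h i I; rewrite /= in_itv.
apply: closed_bigI => i _; apply: closed_comp; last exact: itv_closed.
by move=> y _; exact: coord_continuous.
Qed.

Lemma continuous_reflect (R : realType) (V : normedModType R) (x : V) :
  continuous (fun y : V => 2 *: x - y).
Proof. by move=> y; apply: cvgB; [exact: cvg_cst|exact: cvg_id]. Qed.

Lemma closed_boundary (T : topologicalType) (A : set T) : closed (boundary A).
Proof.
rewrite /boundary setDE; apply: closedI; first exact: closed_closure.
by apply: open_closedC; exact: open_interior.
Qed.

(** * Hausdorff measure *)

Section hausdorff_theory.
Context (R : realType) (d m : nat).
Local Notation V := 'rV[R]_m.
Local Notation H := (hausdorff_outer R d m).
Implicit Types A B X : set V.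

Lemma unit_ball_volume_gt0 k : 0 < unit_ball_volume R k.
Proof.
suff: (0 < unit_ball_volume R k) && (0 < unit_ball_volume R k.+1) by case/andP.
elim: k => [|k /andP[k0 k1]]; first by rewrite /= ltr01 ltr0n.
by rewrite k1/= mulr_gt0// divr_gt0// mulr_gt0// pi_gt0.
Qed.

Lemma le_ediam A B : A `<=` B -> (ediam A <= ediam B)%E.
Proof.
by move=> AB; apply: le_ereal_sup => _ [[a b] [/= /AB Ba /AB Bb] <-]; exists (a, b).
Qed.

Lemma enorm_le_ediam A x y : A x -> A y -> ((enorm (x - y))%:E <= ediam A)%E.
Proof. by move=> Ax Ay; apply: ereal_sup_ubound; exists (x, y). Qed.

Lemma ediam_ge0 A : A !=set0 -> (0 <= ediam A)%E.
Proof.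
move=> [x Ax]; apply: le_trans (enorm_le_ediam Ax Ax).
by rewrite lee_fin enorm_ge0.
Qed.

Lemma hausdorff_weight0 : hausdorff_weight d (set0 : set V) = 0%E.
Proof. by rewrite /hausdorff_weight eqxx. Qed.

Lemma hausdorff_weight_ge0 A : (0 <= hausdorff_weight d A)%E.
Proof.
rewrite /hausdorff_weight; case: ifPn => // /set0P/ediam_ge0 A0.
by rewrite mule_ge0 ?lee_fin ?(ltW (unit_ball_volume_gt0 _))// expe_ge0// mule_ge0.
Qed.

Lemma le_hausdorff_weight A B : A `<=` B ->
  (hausdorff_weight d A <= hausdorff_weight d B)%E.
Proof.
move=> AB; have [->|/set0P A0] := eqVneq A set0.
  by rewrite hausdorff_weight0 hausdorff_weight_ge0.
have /set0P B0 : B !=set0 by case: A0 => x /AB Bx; exists x.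
have /set0P A0' := A0.
rewrite /hausdorff_weight (negbTE A0') (negbTE B0).
apply: lee_wpmul2l; first by rewrite lee_fin ltW// unit_ball_volume_gt0.
have hA : (0 <= (2^-1)%:E * ediam A)%E by rewrite mule_ge0 ?ediam_ge0.
have hAB : ((2^-1)%:E * ediam A <= (2^-1)%:E * ediam B)%E.
  by apply: lee_wpmul2l => //; exact: le_ediam.
elim: d => [|k IH]; first by rewrite !expe0.
rewrite !expeS; apply: lee_pmul => //; exact: expe_ge0.
Qed.

Lemma hausdorff_delta_ge0 (e : R) A : (0 <= hausdorff_delta d e A)%E.
Proof.
by apply: cover_outer_ge0 => B _; exact: hausdorff_weight_ge0.
Qed.

Lemma hausdorff_delta_le (e e' : R) A : e <= e' ->
  (hausdorff_delta d e' A <= hausdorff_delta d e A)%E.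
Proof.
move=> ee'; apply: ereal_inf_le_tmp => _ [F [DF AF] <-].
exists F => //; split => // k; apply: (le_trans (DF k)).
by rewrite lee_fin.
Qed.

Lemma hausdorff_delta_le_outer (e : R) A : 0 < e -> (hausdorff_delta d e A <= H A)%E.
Proof. by move=> e0; apply: ereal_sup_ubound; exists e. Qed.

(** A set of diameter less than eta meets only one of A and B, so a fine cover
    of the union splits into a cover of A and a cover of B. *)
Lemma hausdorff_outer_separated A B (eta : R) : 0 < eta ->
  (forall a b, A a -> B b -> eta <= enorm (a - b)) ->
  (H A + H B <= H (A `|` B))%E.
Proof.
move=> eta0 sep.
have deltaU e : 0 < e -> e < eta ->
    (hausdorff_delta d e A + hausdorff_delta d e B <= hausdorff_delta d e (A `|` B))%E.
  move=> e0 e_eta; apply: le_ereal_inf_tmp => _ [F [DF ABF] <-].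
  have weightU k : (hausdorff_weight d (F k `&` A) + hausdorff_weight d (F k `&` B)
                    <= hausdorff_weight d (F k))%E.
    have [->|/set0P[a [Fa Aa]]] := eqVneq (F k `&` A) set0.
      by rewrite hausdorff_weight0 add0e; exact: le_hausdorff_weight.
    rewrite (_ : F k `&` B = set0).
      by rewrite hausdorff_weight0 adde0; exact: le_hausdorff_weight.
    apply/eqP/negPn/negP => /set0P[b [Fb Bb]].
    have := le_trans (enorm_le_ediam Fa Fb) (DF k).
    by rewrite lee_fin leNgt (lt_le_trans e_eta)// sep.
  apply: le_trans (lee_nneseries _ (fun k _ => weightU k)); last first.
    by move=> k _ _; rewrite adde_ge0 ?hausdorff_weight_ge0.
  rewrite nneseriesD; [|by move=> k _ _; exact: hausdorff_weight_ge0..].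
  apply: leeD; apply: ereal_inf_lbound.
    exists (fun k => F k `&` A) => //; split => [k|x Ax].
      by apply: le_trans (DF k); exact: le_ediam.
    by have [|k _ Fx] := ABF x; [left|exists k].
  exists (fun k => F k `&` B) => //; split => [k|x Bx].
    by apply: le_trans (DF k); exact: le_ediam.
  by have [|k _ Fx] := ABF x; [right|exists k].
have deltaM (e1 e2 : R) : 0 < e1 -> 0 < e2 ->
    (hausdorff_delta d e1 A + hausdorff_delta d e2 B <= H (A `|` B))%E.
  move=> e10 e20; pose e := Num.min (eta / 2) (Num.min e1 e2).
  have e0 : 0 < e by rewrite !lt_min e10 e20 divr_gt0.
  have e_eta : e < eta by rewrite gt_min; apply/orP; left; lra.
  apply: le_trans (hausdorff_delta_le_outer _ e0).
  apply: le_trans (deltaU _ e0 e_eta).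
  by apply: leeD; apply: hausdorff_delta_le; rewrite !ge_min lexx !orbT.
have [->|Hoo] := eqVneq (H (A `|` B)) +oo%E; first by rewrite leey.
have fin x : (0 <= x)%E -> (x <= H (A `|` B))%E -> x \is a fin_num.
  move=> x0 xM; rewrite ge0_fin_numE//; apply: (le_lt_trans xM).
  by rewrite ltey.
have HAfin : H A \is a fin_num.
  by apply: fin; rewrite ?outer_measure_ge0//; apply: le_outer_measure; left.
rewrite addeC -leeBrDr//; apply: ge_ereal_sup => _ [e2 e20 <-].
have h2fin : hausdorff_delta d e2 B \is a fin_num.
  apply: fin; rewrite ?hausdorff_delta_ge0//.
  apply: le_trans (hausdorff_delta_le_outer B e20) _.
  by apply: le_outer_measure; right.
rewrite leeBrDr// addeC -leeBrDr//; apply: ge_ereal_sup => _ [e1 e10 <-].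
by rewrite leeBrDr//; exact: deltaM.
Qed.

(** Caratheodory's criterion. The part A k of X lying at distance more than
    1 / (k + 1) from the half-space P is separated from X intersected with P,
    so it remains to see that A k exhausts the measure of X outside P. The
    slabs S k lying between A k and A (k + 1) satisfy a k + s (k + 1) <= a (k + 2)
    by separation again; these inequalities telescope, so the sum of the
    measures of the slabs beyond A k is controlled by the distance of a k to its
    supremum L. *)
Lemma hausdorff_outer_half_space (i : 'I_m) (c : R) :
  H.-caratheodory [set y : V | y ord0 i <= c].
Proof.
apply: le_caratheodory_measurable => X; set P := [set y | _].
have [HXoo|HXoo] := eqVneq (H X) +oo%E; first by rewrite [leRHS]HXoo leey.
have fin Y : Y `<=` X -> H Y \is a fin_num.
  move=> YX; rewrite ge0_fin_numE ?outer_measure_ge0//.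
  by apply: (le_lt_trans (le_outer_measure _ _ _ YX)); rewrite ltey.
pose A k := [set y | X y /\ c + k.+1%:R^-1 < y ord0 i].
pose S k := [set y | X y /\ c + k.+2%:R^-1 < y ord0 i <= c + k.+1%:R^-1].
pose a k := fine (H (A k)).
pose s k := fine (H (S k)).
have AX k : A k `<=` X by move=> y [].
have SX k : S k `<=` X by move=> y [].
have aE k : H (A k) = (a k)%:E by rewrite fineK// fin.
have sE k : H (S k) = (s k)%:E by rewrite fineK// fin.
have s_ge0 k : 0 <= s k by rewrite fine_ge0// outer_measure_ge0.
have inv_lt k : (k.+2%:R^-1 : R) < k.+1%:R^-1.
  by rewrite ltf_pV2 ?posrE ?ltr0n// ltr_nat.
have a_le k l : (k <= l)%N -> a k <= a l.
  move=> kl; rewrite -lee_fin -!aE; apply: le_outer_measure => y [Xy yc].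
  split => //; apply: le_lt_trans yc; rewrite lerD2l lef_pV2 ?posrE ?ltr0n//.
  by rewrite ler_nat ltnS.
have step k : a k + s k.+1 <= a k.+2.
  rewrite -lee_fin EFinD -!aE -sE.
  apply: (@le_trans _ _ (H (A k `|` S k.+1))).
    apply: (@hausdorff_outer_separated _ _ (k.+1%:R^-1 - k.+2%:R^-1)).
      by rewrite subr_gt0.
    move=> y z [_ yk] [_ /andP[_ zk]].
    apply: le_trans (normr_coord_le_enorm _ i); rewrite !mxE.
    apply: le_trans (ler_norm _); move: yk zk.
    by set u := k.+1%:R^-1; set v := k.+2%:R^-1; lra.
  apply: le_outer_measure => y [[Xy yk]|[Xy /andP[yk _]]]; split => //.
  by apply: lt_trans yk; rewrite ltrD2l (lt_trans (inv_lt _)).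
have HP k : (H (X `&` P) + (a k)%:E <= H X)%E.
  rewrite -aE; apply: (@le_trans _ _ (H ((X `&` P) `|` A k))).
    apply: (@hausdorff_outer_separated _ _ k.+1%:R^-1) => //.
    move=> y z [_ yP] [_ zk]; rewrite -enormN opprB.
    apply: le_trans (normr_coord_le_enorm _ i); rewrite !mxE.
    apply: le_trans (ler_norm _); move: yP zk; rewrite /P /=.
    by set u := k.+1%:R^-1; lra.
  by apply: le_outer_measure => y [[]|[]].
pose L := sup (range a).
have a_ub : has_ubound (range a).
  exists (fine (H X)) => _ [k _ <-]; apply: fine_le; rewrite ?fin//.
  exact: le_outer_measure.
have aL k : a k <= L by apply: ub_le_sup => //; exists k.
have XPfin : H (X `&` P) \is a fin_num by apply: fin; exact: subIsetl.
have HPL : (H (X `&` P) + L%:E <= H X)%E.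
  rewrite addeC -leeBrDr// -(fineK (fin X (fun=> id))) -(fineK XPfin) -EFinB lee_fin.
  apply: ge_sup; first by exists (a 0%N), 0%N.
  move=> _ [k _ <-].
  rewrite -lee_fin EFinB (fineK XPfin) (fineK (fin X (fun=> id))) leeBrDr// addeC.
  exact: HP.
apply: le_trans HPL; apply: leeD => //.
have telescope (t a0 a1 a2 b0 b1 s0 : R) : t <= a0 + a1 - b0 - b1 ->
    a0 + s0 <= a2 -> t + s0 <= a1 + a2 - b0 - b1 by lra.
have tail k N : \sum_(0 <= j < N) s (k + j).+1 <= L + L - a k - a k.+1.
  apply: (@le_trans _ _ (a (k + N)%N + a (k + N).+1 - a k - a k.+1)); last first.
    by rewrite !lerD2r lerD.
  elim: N => [|N IH]; first by rewrite big_nil addn0; lra.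
  rewrite big_nat_recr; last by [].
  rewrite addnS; exact: telescope IH (step (k + N)%N).
apply/lee_addgt0Pr => e e0.
have [_ [k _ <-] ak] : exists2 x, range a x & L - e / 2 < x.
  by apply: sup_adherent; [rewrite divr_gt0|split => //; exists (a 0%N), 0%N].
apply: (@le_trans _ _ ((a k.+1)%:E + (L + L - a k - a k.+1)%:E)%E); last first.
  by rewrite -!EFinD lee_fin; have := aL k; have := a_le k k.+1 (leqnSn _); rewrite -/L in ak; lra.
apply: (@le_trans _ _ (H (A k.+1 `|` \bigcup_j S (k + j).+1))).
  apply: le_outer_measure => y [Xy /negP]; rewrite -ltNge => cy.
  have [N cN] : exists N, c + N.+1%:R^-1 < y ord0 i.
    have yc0 : 0 < y ord0 i - c by rewrite subr_gt0.
    have [N] := ltr_add_invr yc0.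
    rewrite add0r; set u := N.+1%:R^-1 => h; exists N; rewrite -/u; lra.
  have [kN|Nk] := leqP N k.+1.
    left; split => //; apply: le_lt_trans cN.
    by rewrite lerD2l lef_pV2 ?posrE ?ltr0n// ler_nat ltnS.
  have [yk|yk] := ltP (c + k.+2%:R^-1) (y ord0 i); first by left.
  right; elim: N cN Nk => // N IH cN Nk.
  have [yN|yN] := leP (y ord0 i) (c + N.+1%:R^-1).
    exists (N - k.+1)%N => //; split => //.
    by rewrite addnC -addnS subnK// cN.
  apply: IH => //; rewrite ltn_neqAle -ltnS Nk andbT.
  by apply/eqP => kN; move: yN; rewrite -kN ltNge yk.
apply: le_trans (outer_measureU2 _ _ _) _.
rewrite [X in (X + _)%E]aE leeD2l//.
apply: le_trans (outer_measure_sigma_subadditive _ _) _.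
apply: lime_le; first by apply: is_cvg_nneseries => j _ _; exact: outer_measure_ge0.
apply: nearW => N.
rewrite (eq_bigr (fun j => (s (k + j).+1)%:E)) => [|j _]; last exact: sE.
by rewrite sumEFin lee_fin tail.
Qed.

End hausdorff_theory.

(** If f is 2-Lipschitz for the sup norm of the target, the image of a set of
    diameter D lies in a cube of side 4 D. A cover of A thus yields a cover of
    the cube of half-side r by cubes, and volumes are subadditive. *)
Lemma hausdorff_outer_ge_of_covers_cube (R : realType) (n m : nat)
    (A : set 'rV[R]_m) (f : 'rV[R]_m -> 'rV[R]_n.+1) (r : R) : 0 < r ->
  (forall y z j, `|f y ord0 j - f z ord0 j| <= 2 * enorm (y - z)) ->
  (forall w : 'rV[R]_n.+1, (forall j, `|w ord0 j| <= r) -> (f @` A) w) ->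
  ((unit_ball_volume R n.+1 * (r / 4) ^+ n.+1)%:E <= hausdorff_outer R n.+1 m A)%E.
Proof.
move=> r0 flip fA.
set om := unit_ball_volume R n.+1.
have om0 : 0 < om by exact: unit_ball_volume_gt0.
apply: le_trans (hausdorff_delta_le_outer _ _ ltr01).
apply: le_ereal_inf_tmp => _ [F [DF AF] <-].
have imF k : (lebesgue_outer R n (f @` F k) <=
    (8 ^+ n.+1 / om)%:E * hausdorff_weight n.+1 (F k))%E.
  have [->|/set0P[p Fp]] := eqVneq (F k) set0.
    by rewrite image_set0 outer_measure0 hausdorff_weight0 mule0.
  have dfin : ediam (F k) \is a fin_num.
    rewrite ge0_fin_numE; last by apply: ediam_ge0; exists p.
    exact: le_lt_trans (DF k) (ltry _).
  pose D := fine (ediam (F k)).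
  have dE : ediam (F k) = D%:E by rewrite fineK.
  have D0 : 0 <= D by apply: fine_ge0; apply: ediam_ge0; exists p.
  have -> : ((8 ^+ n.+1 / om)%:E * hausdorff_weight n.+1 (F k) =
             ((4 * D) ^+ n.+1)%:E)%E.
    rewrite /hausdorff_weight -/om; case: ifPn => [/eqP F0|_].
      by move: Fp; rewrite F0.
    rewrite dE -EFinM -EFin_expe -!EFinM; congr (_%:E).
    rewrite !exprMn exprVn.
    rewrite (_ : 8 = 4 * 2 :> R); last by ring.
    by rewrite exprMn; field; rewrite expf_neq0//= gt_eqF.
  pose a : 'rV[R]_n.+1 := \row_j (f p ord0 j - 2 * D).
  pose b : 'rV[R]_n.+1 := \row_j (f p ord0 j + 2 * D).
  have -> : (4 * D) ^+ n.+1 = \prod_j (b ord0 j - a ord0 j).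
    rewrite -[in LHS](card_ord n.+1) -prodr_const; apply: eq_bigr => j _; rewrite !mxE; ring.
  apply: le_trans (lebesgue_outer_closed_box_le _); last first.
    by move=> j; rewrite !mxE; lra.
  apply: le_outer_measure => _ [q Fq <-] j; rewrite !mxE.
  have := enorm_le_ediam Fq Fp; rewrite dE lee_fin => qp.
  by have := flip q p j; rewrite ler_norml; lra.
pose a : 'rV[R]_n.+1 := \row_j (- r).
pose b : 'rV[R]_n.+1 := \row_j r.
have abD : box_index (a, b) by move=> j; rewrite !mxE; lra.
have cube : ((\prod_(j < n.+1) (2 * r))%:E <=
    (8 ^+ n.+1 / om)%:E * \sum_(k <oo) hausdorff_weight n.+1 (F k))%E.
  have -> : (\prod_(j < n.+1) (2 * r))%:E = box_volume (a, b).
    by congr (_%:E); apply: eq_bigr => j _; rewrite !mxE; ring.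
  apply: le_trans (lebesgue_outer_box_ge abD) _.
  apply: (@le_trans _ _ (lebesgue_outer R n (\bigcup_k (f @` F k)))).
    apply: le_outer_measure => w abw.
    have [|y /AF[k _ Fy] <-] := fA w; last by exists k => //; exists y.
    by move=> j; have := abw j; rewrite !mxE ler_norml; lra.
  apply: le_trans (outer_measure_sigma_subadditive _ _) _.
  rewrite -nneseriesZl; last by move=> k _; exact: hausdorff_weight_ge0.
  by apply: lee_nneseries => k _ => [_|]; [exact: outer_measure_ge0|exact: imF].
have c0 : 0 < om / 8 ^+ n.+1 by rewrite divr_gt0// exprn_gt0.
have -> : (om * (r / 4) ^+ n.+1)%:E =
    ((om / 8 ^+ n.+1)%:E * (\prod_(j < n.+1) (2 * r))%:E)%E.
  rewrite -EFinM; congr (_%:E); rewrite prodr_const card_ord !exprMn exprVn.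
  rewrite (_ : 8 = 4 * 2 :> R); last by ring.
  by rewrite exprMn; field; rewrite !expf_neq0.
have -> : (\sum_(k <oo) hausdorff_weight n.+1 (F k) = (om / 8 ^+ n.+1)%:E *
    ((8 ^+ n.+1 / om)%:E * \sum_(k <oo) hausdorff_weight n.+1 (F k)))%E.
  rewrite muleA -EFinM (_ : om / 8 ^+ n.+1 * (8 ^+ n.+1 / om) = 1) ?mul1e//.
  by field; rewrite gt_eqF//= expf_neq0.
by rewrite lee_pmul2l.
Qed.

(** * The kernel of the nonlocal curvature *)

Lemma sum_geometric_le (R : realFieldType) (q : R) N : 0 <= q < 1 ->
  \sum_(0 <= k < N) q ^+ k <= (1 - q)^-1.
Proof.
move=> /andP[q0 q1]; have q10 : 0 < 1 - q by rewrite subr_gt0.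
rewrite -[leRHS]mul1r ler_pdivlMr//.
suff -> : (\sum_(0 <= k < N) q ^+ k) * (1 - q) = 1 - q ^+ N.
  by rewrite gerBl exprn_ge0.
elim: N => [|N IH]; first by rewrite big_nil mul0r expr0 subrr.
by rewrite big_nat_recr//= mulrDl IH exprS; ring.
Qed.

Section riesz_kernel.
Context (R : realType) (m : nat) (alpha : R) (x : 'rV[R]_m.+1).
Hypothesis alpha_gt0 : 0 < alpha.
Local Notation V := 'rV[R]_m.+1.
Local Notation mu := (lebesgue_rV R m).
Local Notation T := (caratheodory_type (lebesgue_outer R m)).
Local Notation e := (m.+1%:R + alpha).

(** The absolute value of the integrand in the definition of the nonlocal
    curvature at x. *)
Definition riesz_kernel (y : T) : \bar R :=
  (((enorm ((y : V) - x)) `^ e)^-1)%:E.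

Local Notation far eps := [set y : T | (eps <= enorm ((y : V) - x))%R].

Lemma open_lebesgue_measurable (U : set V) : open U -> measurable (U : set T).
Proof. exact: (open_caratheodory (@lebesgue_outer_half_space R m)). Qed.

Lemma closed_lebesgue_measurable (F : set V) : closed F -> measurable (F : set T).
Proof. exact: (closed_caratheodory (@lebesgue_outer_half_space R m)). Qed.

Lemma measurable_far eps : measurable (far eps).
Proof.
apply: closed_lebesgue_measurable.
apply: (@closed_comp _ _ (fun y : V => enorm (y - x)) [set t | eps <= t]).
  by move=> y _; exact: continuous_enormB.
exact: closed_ge.
Qed.

Lemma riesz_kernel_ge0 y : (0 <= riesz_kernel y)%E.
Proof. by rewrite lee_fin invr_ge0 powR_ge0. Qed.

Lemma measurable_riesz_kernel (D : set T) : measurable_fun D riesz_kernel.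
Proof.
apply/measurable_EFinP.
have -> : (fun y : T => ((enorm ((y : V) - x)) `^ e)^-1) =
    (fun t : R => t `^ (- e)) \o (fun y : T => enorm ((y : V) - x)).
  by apply/funext => y /=; rewrite powRN.
apply: measurableT_comp; first exact: measurable_powR.
apply: (continuous_caratheodory (@lebesgue_outer_half_space R m)).
exact: continuous_enormB.
Qed.

(** Dyadic decomposition: for 2 ^ k eps <= |y - x| < 2 ^ (k + 1) eps, the kernel
    is at most (2 ^ k eps)^-(m+1+alpha), while y is in a cube of volume
    (4 * 2 ^ k eps)^(m+1). The products form a geometric series of ratio
    2 ^ (- alpha). *)
Lemma riesz_kernel_far_lty eps : 0 < eps ->
  (\int[mu]_(y in far eps) riesz_kernel y < +oo)%E.
Proof.
move=> eps0.
pose t k : R := 2 ^+ k * eps.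
have t0 k : 0 < t k by rewrite mulr_gt0// exprn_gt0.
pose Q k : set T := [set y : T | forall i,
  x ord0 i - 2 * t k <= (y : V) ord0 i <= x ord0 i + 2 * t k].
have mQ k : measurable (Q k) by apply: closed_lebesgue_measurable; exact: closed_cube.
have muQ k : (mu (Q k) <= ((4 * t k) ^+ m.+1)%:E)%E.
  pose a : V := \row_i (x ord0 i - 2 * t k).
  pose b : V := \row_i (x ord0 i + 2 * t k).
  have -> : (4 * t k) ^+ m.+1 = \prod_i (b ord0 i - a ord0 i).
    rewrite -[in LHS](card_ord m.+1) -prodr_const; apply: eq_bigr => i _.
    by rewrite !mxE; ring.
  apply: le_trans (lebesgue_outer_closed_box_le _); last first.
    by move=> i; rewrite !mxE; have := t0 k; lra.
  by apply: le_outer_measure => y yQ i; rewrite !mxE; exact: yQ.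
pose c k : R := t k `^ (- e).
pose f k (y : T) : \bar R := ((c k)%:E * (\1_(Q k) y)%:E)%E.
have f0 k y : (0 <= f k y)%E by rewrite mule_ge0 ?lee_fin// powR_ge0.
have mf k (D : set T) : measurable_fun D (f k).
  apply: measurable_funeM; apply/measurable_EFinP; apply: measurable_indic.
  exact: mQ.
have kernel_le y : far eps y -> (riesz_kernel y <= \sum_(k <oo) f k y)%E.
  move=> /= epsy; pose d := enorm ((y : V) - x).
  have ex_k : exists k, d < t k.+1.
    have [k dk] : exists k : nat, d / eps < k%:R.
      exists (Num.truncn (d / eps)).+1; apply: truncnS_gt.
    exists k; rewrite /t -ltr_pdivrMr//; apply: (lt_le_trans dk).
    rewrite -natrX ler_nat; apply: leq_trans (ltnW (ltn_expl k (ltnSn 1))) _.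
    by rewrite leq_exp2l.
  case: (ex_minnP ex_k) => k dk kmin.
  have tkd : t k <= d.
    case: k dk kmin => [|k] dk kmin; first by rewrite /t expr0 mul1r.
    by rewrite leNgt; apply/negP => /kmin; rewrite ltnn.
  apply: (@le_trans _ _ (f k y)).
    have Qy : Q k y.
      move=> i; have := normr_coord_le_enorm ((y : V) - x) i; rewrite !mxE -/d.
      have -> : 2 * t k = t k.+1 by rewrite /t exprS; ring.
      by rewrite ler_norml; lra.
    rewrite /f indicE mem_set// mule1 lee_fin /c powRN lef_pV2 ?posrE ?powR_gt0//.
      apply: ge0_ler_powR => //; rewrite ?nnegrE ?(ltW (t0 _))//.
      by rewrite addr_ge0// ltW.
      exact: enorm_ge0.
    by rewrite -/d (lt_le_trans (t0 k)).
  apply: le_trans (nneseries_lim_ge k.+1 _); last by move=> n _ _; exact: f0.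
  by rewrite big_nat_recr//= leeDr// sume_ge0.
have mfar := measurable_far eps.
apply: (@le_lt_trans _ _ (\int[mu]_(y in far eps) (\sum_(k <oo) f k y))%E).
  apply: ge0_le_integral; [exact: mfar| | | |exact: kernel_le].
  - by move=> y _; exact: riesz_kernel_ge0.
  - exact: measurable_riesz_kernel.
  - by have := @ge0_emeasurable_sum _ _ _ (far eps) f xpredT
      (fun k y _ _ => f0 k y) (fun k _ => mf k _).
rewrite integral_nneseries//.
pose q : R := 2 `^ (- alpha).
have q0 : 0 <= q by exact: powR_ge0.
have q1 : q < 1.
  have h : 1 < 2 `^ alpha :> R.
    have := @gt0_ltr_powR R alpha alpha_gt0 1 2.
    by rewrite powR1; apply; rewrite ?nnegrE// ltr1n.
  by rewrite /q powRN invf_lt1 ?powR_gt0.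
pose A : R := 4 ^+ m.+1 * eps `^ (- alpha).
have A0 : 0 <= A by rewrite mulr_ge0 ?exprn_ge0 ?powR_ge0.
have intf k : (\int[mu]_(y in far eps) f k y <= (A * q ^+ k)%:E)%E.
  have mind : measurable_fun (far eps) (fun y : T => (\1_(Q k) y : R)%:E).
    by apply/measurable_EFinP; apply: measurable_indic; exact: mQ.
  have ind0 (y : T) : far eps y -> (0 <= (\1_(Q k) y : R)%:E)%E by rewrite lee_fin.
  rewrite /f (ge0_integralZl_EFin mu mfar ind0 mind (powR_ge0 _ _)).
  rewrite integral_indic; [|exact: mfar|exact: mQ].
  apply: (@le_trans _ _ ((c k)%:E * ((4 * t k) ^+ m.+1)%:E)%E).
    apply: lee_wpmul2l; first by rewrite lee_fin powR_ge0.
    apply: le_trans (muQ k); apply: le_measure; rewrite ?inE; last exact: subIsetl.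
      by apply: measurableI; [exact: mQ|].
    exact: mQ.
  rewrite -EFinM lee_fin /c opprD powRD; last by rewrite (gt_eqF (t0 k)) implybT.
  rewrite exprMn powRN powR_mulrn ?(ltW (t0 k))//.
  rewrite [X in _ <= X](_ : _ = 4 ^+ m.+1 * t k `^ (- alpha)); last first.
    rewrite /A -mulrA; congr (_ * _); rewrite /t mulrC powRM ?exprn_ge0 ?ltW//.
    congr (_ * _); rewrite /q.
    rewrite -(powR_mulrn k (powR_ge0 2 (- alpha))) -(powR_mulrn k (ler0n R 2)).
    by rewrite -!powRrM mulrC.
  rewrite le_eqVlt; apply/orP; left; apply/eqP; field.
  by rewrite expf_neq0// gt_eqF.
apply: (@le_lt_trans _ _ (A * (1 - q)^-1)%:E); last exact: ltry.
apply: lime_le; first by apply: is_cvg_nneseries => k _ _; exact: integral_ge0.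
apply: nearW => N.
apply: (@le_trans _ _ (\sum_(0 <= k < N) (A * q ^+ k)%:E)%E).
  by apply: lee_sum => k _; exact: intf.
rewrite sumEFin lee_fin -mulr_sumr ler_wpM2l// sum_geometric_le//.
by rewrite q0.
Qed.

(** Change of variables: the reflection pushes the measure forward to itself. *)
Lemma integral_reflect (D : set T) (f : T -> \bar R) :
  measurable D -> measurable_fun D f -> (forall y, (0 <= f y)%E) ->
  (\int[mu]_(y in [set y : T | D (2 *: x - (y : V))%R]) f (2 *: x - (y : V))%R =
   \int[mu]_(y in D) f y)%E.
Proof.
move=> mD mf f0.
pose phi : T -> T := fun y => 2 *: x - (y : V).
have muphi (A : set T) : mu (phi @^-1` A) = mu A.
  exact: (lebesgue_outer_reflect x A).
have phi_cara (A : set V) : (lebesgue_outer R m).-caratheodory A ->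
    (lebesgue_outer R m).-caratheodory [set y | A (2 *: x - y)].
  move=> mA X; have reflE := lebesgue_outer_reflect x.
  rewrite -(reflE X) -(reflE (X `&` _)) -(reflE (X `&` ~` _)) [LHS](mA _).
  congr (lebesgue_outer R m _ + lebesgue_outer R m _)%E.
    by apply/funext => y /=; rewrite subKr.
  by apply/funext => y /=; rewrite subKr.
have mphi : measurable_fun setT phi.
  by move=> _ A mA; rewrite setTI; exact: phi_cara.
rewrite -[LHS](@ge0_integral_pushforward _ _ T T R phi mphi mu D f mD mf); last first.
  by move=> y _; exact: f0.
pose mphi_mixin := isMeasurableFun.Build _ _ _ _ _ mphi.
pose mphi_pack : {mfun T >-> T} := HB.pack phi mphi_mixin.
apply: (@eq_measure_integral _ _ _ _ mu (pushforward mu mphi_pack)).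
by move=> A mA _; exact: muphi.
Qed.

End riesz_kernel.

(** * Lower bound for the nonlocal curvature *)

Section principal_value.
Context (R : realType) (n : nat) (alpha : R) (Omega : set 'rV[R]_n.+1)
  (x : 'rV[R]_n.+1).
Hypotheses (alpha_gt0 : 0 < alpha) (oO : open Omega) (cO : convex_set Omega)
  (xO : ~ Omega x).
Local Notation V := 'rV[R]_n.+1.
Local Notation mu := (lebesgue_rV R n).
Local Notation T := (caratheodory_type (lebesgue_outer R n)).
Local Notation far eps := [set y : T | (eps <= enorm ((y : V) - x))%R].
Local Notation ker := (riesz_kernel alpha x).

(* The reflection of Omega through x is disjoint from Omega; Z is what remains
   when both are removed. *)
Let OmegaR : set V := [set y | Omega (2 *: x - y)].
Let Z : set V := ~` (Omega `|` OmegaR).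

Let mOmega : measurable (Omega : set T).
Proof. exact: open_lebesgue_measurable. Qed.

Let mOmegaR : measurable (OmegaR : set T).
Proof.
apply: open_lebesgue_measurable.
have cf : continuous (fun y : V => 2 *: x - y).
  exact: continuous_reflect.
by apply: open_comp => // y _; exact: cf.
Qed.

Let disjO (y : V) : Omega y -> OmegaR y -> False.
Proof.
move=> Oy OyR; apply: xO.
have half01 : 0 <= (2^-1 : R) <= 1 by apply/andP; split; lra.
have := convex_set_comb cO half01 Oy OyR.
by congr Omega; apply/rowP => i; rewrite !mxE; lra.
Qed.

(** The negative part of the integrand lives on Omega and the positive part on
    the disjoint union of Z and of the reflection of Omega. The kernel is even
    about x, so the contributions of Omega and of its reflection cancel; they
    are finite because the kernel is integrable away from x. *)
Lemma curvature_integral_truncated eps : 0 < eps ->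
  (\int[mu]_(y in far eps)
     ((\1_(~` Omega) y - \1_Omega y) / (enorm ((y : V) - x)) `^ (n.+1%:R + alpha))%:E
   = \int[mu]_(y in far eps `&` Z) ker y)%E.
Proof.
move=> eps0; have mfar := measurable_far x eps.
have mk D := @measurable_riesz_kernel R n alpha x D.
have k0 y := riesz_kernel_ge0 alpha x y.
set f := (X in (\int[mu]_(y in _) X y)%E).
have fpos y : (f^\+ y = (ker \_ (~` Omega)) y)%E.
  rewrite funeposE /f patchE !indicE in_setC.
  case: (y \in Omega) => /=.
    rewrite sub0r mulN1r; apply/max_idPr; rewrite lee_fin oppr_le0.
    by rewrite invr_ge0 powR_ge0.
  by rewrite subr0 mul1r; apply/max_idPl; exact: k0.
have fneg y : (f^\- y = (ker \_ Omega) y)%E.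
  rewrite funenegE /f patchE !indicE in_setC.
  case: (y \in Omega) => /=.
    by rewrite sub0r mulN1r opprK; apply/max_idPl; exact: k0.
  rewrite subr0 mul1r; apply/max_idPr.
  by rewrite lee_fin oppr_le0 invr_ge0 powR_ge0.
rewrite integralE (eq_integral _ _ (fun y _ => fpos y)).
rewrite (eq_integral _ _ (fun y _ => fneg y)) -!integral_mkcondr.
have reflO : (\int[mu]_(y in far eps `&` OmegaR) ker y =
              \int[mu]_(y in far eps `&` Omega) ker y)%E.
  have mDO : measurable (far eps `&` Omega : set T) by exact: measurableI.
  rewrite -[RHS](@integral_reflect R n x _ ker mDO (mk _) k0).
  have refl_dist y : enorm (2 *: x - y - x) = enorm (y - x).
    by rewrite -enormN; congr enorm; apply/rowP => i; rewrite !mxE; ring.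
  have -> : [set y : T | (far eps `&` Omega) (2 *: x - (y : V))] =
      far eps `&` OmegaR.
    by apply/seteqP; split => y [] /=; rewrite refl_dist.
  by apply: eq_integral => y _; rewrite /riesz_kernel refl_dist.
have -> : far eps `&` ~` Omega = (far eps `&` OmegaR) `|` (far eps `&` Z).
  apply/seteqP; split => y.
    move=> [ye Oy]; have [OyR|nOyR] := pselect (OmegaR y); first by left.
    by right; split => // -[].
  by move=> [[ye OyR]|[ye Zy]]; split => // Oy; [exact: (disjO Oy OyR)|apply: Zy; left].
have mZ : measurable (Z : set T) by apply: measurableC; exact: measurableU.
rewrite ge0_integral_setU//; [| exact: measurableI | exact: measurableI | ]; last first.
  by apply/eqP/seteqP; split => // y [[_ OyR] [_]]; apply; right.
rewrite reflO addeAC subee ?add0e//.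
rewrite ge0_fin_numE; last exact: integral_ge0.
apply: le_lt_trans (riesz_kernel_far_lty x alpha_gt0 eps0).
by apply: ge0_subset_integral => //; exact: measurableI.
Qed.

(** By [curvature_integral_truncated] the truncated integrals increase as eps
    decreases to 0. The limit therefore exists, and it is at least the integral
    of the kernel over the cube with corner a, where the kernel is bounded below
    because the cube is within distance 6 (n + 1) r of x. *)
Lemma nonlocal_mean_curvature_ge (a : V) (r : R) : 0 < r ->
  (forall y : V, (forall i, a ord0 i <= y ord0 i <= a ord0 i + r) ->
    [/\ ~ Omega y, ~ Omega (2 *: x - y) &
        forall i, r <= `|y ord0 i - x ord0 i| <= 6 * r]) ->
  ((alpha / 2 * (r ^+ n.+1 * (n.+1%:R * (6 * r)) `^ (- (n.+1%:R + alpha))))%:E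
   <= nonlocal_mean_curvature alpha Omega x)%E.
Proof.
move=> r0 aB.
pose B : set T := [set y : T | forall i, a ord0 i <= (y : V) ord0 i <= a ord0 i + r].
have mB : measurable B.
  by apply: closed_lebesgue_measurable; exact: closed_cube.
have mfar eps := measurable_far x eps.
have mk D := @measurable_riesz_kernel R n alpha x D.
have k0 y := riesz_kernel_ge0 alpha x y.
have mZ : measurable (Z : set T) by apply: measurableC; exact: measurableU.
rewrite /nonlocal_mean_curvature EFinM.
apply: lee_wpmul2l; first by rewrite lee_fin divr_ge0// ltW.
pose J (eps : R) := (\int[mu]_(y in far eps) ((\1_(~` Omega) y - \1_Omega y) /
   (enorm ((y : V) - x)) `^ (n.+1%:R + alpha))%:E)%E.
rewrite -[lim _]/(lim (J eps @[eps --> 0^'+])).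
have JE eps : 0 < eps -> J eps = (\int[mu]_(y in far eps `&` Z) ker y)%E.
  exact: curvature_integral_truncated.
have J_mono eps eps' : 0 < eps -> eps <= eps' -> (J eps' <= J eps)%E.
  move=> e0 ee'; rewrite !JE ?(lt_le_trans e0)//.
  apply: ge0_subset_integral => //; [exact: measurableI | exact: measurableI |].
  by move=> y [/= ye Zy]; split => //=; exact: le_trans ye.
apply: lime_ge.
  apply: nonincreasing_at_right_is_cvge; near=> d => e e'.
  by rewrite !in_itv/= => /andP[e0 _] _; exact: J_mono.
near=> eps; have eps0 : 0 < eps by [].
apply: (@le_trans _ _ (J r)); last first.
  by apply: J_mono => //; apply: ltW.
rewrite JE//.
have BZ : B `<=` far r `&` Z.
  move=> y /aB[Oy OyR yr]; split; last by case.
  rewrite /=; apply: le_trans (normr_coord_le_enorm _ ord0); rewrite !mxE.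
  by case/andP: (yr ord0).
apply: (@le_trans _ _ (\int[mu]_(y in B) ker y)%E); last first.
  by apply: ge0_subset_integral => //; exact: measurableI.
pose c : R := (n.+1%:R * (6 * r)) `^ (- (n.+1%:R + alpha)).
apply: (@le_trans _ _ (\int[mu]_(y in B) c%:E)%E); last first.
  apply: ge0_le_integral => //; first by move=> y _; rewrite lee_fin powR_ge0.
  move=> y /aB[_ _ yr]; rewrite /c powRN lee_fin.
  have d0 : 0 < enorm (y - x).
    apply: (lt_le_trans r0); apply: le_trans (normr_coord_le_enorm _ ord0).
    by rewrite !mxE; case/andP: (yr ord0).
  rewrite lef_pV2 ?posrE ?powR_gt0 ?mulr_gt0 ?ltr0n//.
  apply: ge0_ler_powR; rewrite ?nnegrE ?addr_ge0 ?mulr_ge0 ?(ltW d0) ?(ltW r0) ?(ltW alpha_gt0)//.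
  apply: enorm_le_cube => i; rewrite !mxE.
  by case/andP: (yr i).
rewrite integral_cst// mulrC EFinM; apply: lee_wpmul2l.
  by rewrite lee_fin powR_ge0.
pose b : V := \row_i (a ord0 i + r).
have abD : box_index (a, b) by move=> i; rewrite mxE; lra.
have -> : (r ^+ n.+1)%:E = box_volume (a, b).
  congr (_%:E); rewrite -[in LHS](card_ord n.+1) -prodr_const.
  by apply: eq_bigr => i _; rewrite /= mxE; ring.
apply: le_trans (lebesgue_outer_box_ge abD) _.
apply: le_outer_measure => y yab i; have := yab i; rewrite /= mxE.
by case/andP => /ltW -> ->.
Unshelve. all: by end_near. Qed.

End principal_value.

(** * The two terms of the inequality *)

Section boundary_integral.
Context (R : realType) (n : nat).
Local Notation V := 'rV[R]_n.+2.
Local Notation H := (hausdorff R n.+1 n.+2).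
Local Notation om := (unit_ball_volume R n.+1).

(** The projection along the diagonal with signs v is 2-Lipschitz for the sup
    norm of the target. *)
Lemma hausdorff_wide_boundary_ge (A : set V) (x : V) (v : 'I_n.+2 -> bool) (r : R) :
  0 < r ->
  (forall w : 'rV[R]_n.+1, (forall j, `|w ord0 j| <= r) -> exists2 y, A y &
     forall j, (-1) ^+ v (lift ord0 j) * (y - x) ord0 (lift ord0 j) -
               (-1) ^+ v ord0 * (y - x) ord0 ord0 = w ord0 j) ->
  ((om * (r / 4) ^+ n.+1)%:E <= hausdorff_outer R n.+1 n.+2 A)%E.
Proof.
move=> r0 wide.
pose f (y : V) : 'rV[R]_n.+1 := \row_j
  ((-1) ^+ v (lift ord0 j) * (y - x) ord0 (lift ord0 j) -
   (-1) ^+ v ord0 * (y - x) ord0 ord0).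
apply: (@hausdorff_outer_ge_of_covers_cube R n n.+2 A f r r0) => [y z j|w /wide].
  rewrite !mxE.
  have -> (a b c d e g h k : R) :
      a * (b - c) - d * (e - g) - (a * (h - c) - d * (k - g)) =
      a * (b - h) - d * (e - k) by ring.
  apply: le_trans (ler_normB _ _) _; rewrite !normrM !normr_sign !mul1r.
  have := normr_coord_le_enorm (y - z) (lift ord0 j).
  have := normr_coord_le_enorm (y - z) ord0.
  by rewrite !mxE; lra.
by move=> [y Ay yw]; exists y => //; apply/rowP => j; rewrite mxE yw.
Qed.

(** The boundary in the cube of half-side 6 r about x has measure at least 2 m,
    where m is the measure of E. So at least m of it is outside E, and there the
    kernel is at least its value at distance 6 (n + 2) r. *)
Lemma boundary_integral_ge (Omega E : set V) (x : V) (v : 'I_n.+2 -> bool)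
    (r m q : R) :
  0 < r -> 0 < q -> E x ->
  (hausdorff_outer R n.+1 n.+2).-cara.-measurable E -> H E = m%:E ->
  2 * m <= om * (r / 4) ^+ n.+1 ->
  (forall w : 'rV[R]_n.+1, (forall j, `|w ord0 j| <= r) ->
     exists2 y, boundary Omega y &
       (forall i, `|y ord0 i - x ord0 i| <= 6 * r) /\
       forall j, (-1) ^+ v (lift ord0 j) * (y - x) ord0 (lift ord0 j) -
                 (-1) ^+ v ord0 * (y - x) ord0 ord0 = w ord0 j) ->
  (((n.+2%:R * (6 * r)) `^ (- (n.+1%:R + q)) * m)%:E <=
   \int[H]_(y in boundary Omega `\` E)
      ((enorm (x - y)) `^ (- (n.+1%:R + q)))%:E)%E.
Proof.
move=> r0 q0 Ex mE HE m_le wide.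
pose T := caratheodory_type (hausdorff_outer R n.+1 n.+2).
have closed_meas (F : set V) : closed F -> measurable (F : set T).
  exact: (closed_caratheodory (@hausdorff_outer_half_space R n.+1 n.+2)).
pose Q : set V := [set y | forall i, x ord0 i - 6 * r <= y ord0 i <= x ord0 i + 6 * r].
pose A := boundary Omega `&` Q.
have mbd : measurable (boundary Omega : set T).
  by apply: closed_meas; exact: closed_boundary.
have mA : measurable (A : set T).
  by apply: measurableI => //; apply: closed_meas; exact: closed_cube.
have HA : ((2 * m)%:E <= H A)%E.
  apply: (@le_trans _ _ ((om * (r / 4) ^+ n.+1)%:E)); first by rewrite lee_fin.
  apply: (@hausdorff_wide_boundary_ge A x v r r0) => w /wide[y By [yx yw]].
  exists y => //; split => // i.
  by have := yx i; rewrite ler_norml; lra.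
have HAE : (m%:E <= H (A `\` E))%E.
  have : (H A <= H (A `\` E) + m%:E)%E.
    rewrite -HE; apply: le_trans (outer_measureU2 _ _ _).
    apply: le_outer_measure => y Ay; have [Ey|nEy] := pselect (E y); first by right.
    by left.
  move=> /(le_trans HA); rewrite -leeBlDr// -EFinB.
  by rewrite (_ : 2 * m - m = m)//; ring.
pose c : R := (n.+2%:R * (6 * r)) `^ (- (n.+1%:R + q)).
have f0 (y : T) : (0 <= ((enorm (x - (y : V))) `^ (- (n.+1%:R + q)))%:E)%E.
  by rewrite lee_fin powR_ge0.
have mf (D : set T) : measurable_fun D
    (fun y : T => ((enorm (x - (y : V))) `^ (- (n.+1%:R + q)))%:E).
  apply/measurable_EFinP.
  have -> : (fun y : T => (enorm (x - (y : V))) `^ (- (n.+1%:R + q))) =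
    (fun t : R => t `^ (- (n.+1%:R + q))) \o (fun y : T => enorm ((y : V) - x)).
    by apply/funext => y /=; rewrite -enormN opprB.
  apply: measurableT_comp; first exact: measurable_powR.
  apply: (continuous_caratheodory (@hausdorff_outer_half_space R n.+1 n.+2)).
  exact: continuous_enormB.
have mAE : measurable (A `\` E : set T) by exact: measurableD.
apply: (@le_trans _ _ (\int[H]_(y in A `\` E)
      ((enorm (x - y)) `^ (- (n.+1%:R + q)))%:E)%E); last first.
  apply: ge0_subset_integral => //; first exact: measurableD.
  by move=> y [[]].
apply: (@le_trans _ _ (\int[H]_(y in A `\` E) c%:E)%E).
  rewrite integral_cst// EFinM; apply: lee_wpmul2l => //.
  by rewrite lee_fin powR_ge0.
apply: ge0_le_integral => //; first by move=> y _; rewrite lee_fin powR_ge0.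
move=> y [[_ Qy] nEy]; rewrite lee_fin /c !powRN.
have xy0 : 0 < enorm (x - y).
  by apply: enorm_gt0; rewrite subr_eq0; apply/eqP => xy; apply: nEy; rewrite -xy.
rewrite lef_pV2 ?posrE ?powR_gt0 ?mulr_gt0 ?ltr0n//.
apply: ge0_ler_powR; rewrite ?nnegrE ?addr_ge0 ?mulr_ge0 ?(ltW xy0) ?(ltW r0) ?(ltW q0)//.
apply: enorm_le_cube => i; rewrite !mxE ler_norml.
by have := Qy i; lra.
Qed.

End boundary_integral.

Section scaling.
Context (R : realType) (N alpha q m theta K : R).
Hypotheses (N0 : 0 < N) (alpha0 : 0 < alpha) (m0 : 0 < m)
  (theta0 : 0 < theta) (K0 : 0 < K).

(** With lengths proportional to m ^ (1 / N), both lower bounds are multiples of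
    m ^ (- q / N): the scaling of the two sides of the inequality agrees. *)
Lemma scaling_integral :
  (K * m `^ N^-1) `^ (- (N + q)) * m = K `^ (- (N + q)) * m `^ (- (q / N)).
Proof.
rewrite powRM ?powR_ge0 ?(ltW K0)// -mulrA; congr (_ * _).
rewrite -powRrM -[X in _ * X]powRr1 ?(ltW m0)// -powRD ?(gt_eqF m0) ?implybT//.
by congr (_ `^ _); field; rewrite gt_eqF.
Qed.

Lemma scaling_curvature :
  (alpha / 2 * ((theta * m `^ N^-1) `^ (N + 1) *
     (K * m `^ N^-1) `^ (- (N + 1 + alpha)))) `^ (q / alpha) =
  (alpha / 2 * (theta `^ (N + 1) * K `^ (- (N + 1 + alpha)))) `^ (q / alpha) *
     m `^ (- (q / N)).
Proof.
have -> : (theta * m `^ N^-1) `^ (N + 1) * (K * m `^ N^-1) `^ (- (N + 1 + alpha)) =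
    theta `^ (N + 1) * K `^ (- (N + 1 + alpha)) * m `^ (- (alpha / N)).
  rewrite !powRM ?powR_ge0 ?(ltW K0) ?(ltW theta0)// mulrACA; congr (_ * _).
  rewrite -!powRrM -powRD ?(gt_eqF m0) ?implybT//.
  by congr (_ `^ _); field; rewrite gt_eqF.
rewrite mulrA powRM ?powR_ge0 ?mulr_ge0 ?powR_ge0 ?divr_ge0 ?(ltW alpha0)//.
congr (_ * _); rewrite -powRrM; congr (_ `^ _).
by field; rewrite !gt_eqF.
Qed.

End scaling.

(** * Conclusion *)

Theorem proposition3p1 (R : realType) (n : nat) (alpha s p : R)
    (n_ge1 : (1 <= n)%N) (alpha_01 : 0 < alpha < 1) (s_01 : 0 < s < 1)
    (p_gt0 : 0 < p) :
  exists2 C : R, 0 < C &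
  forall Omega : set 'rV[R]_n.+1, open Omega -> convex_set Omega ->
  forall E : set 'rV[R]_n.+1, E `<=` boundary Omega ->
  (hausdorff_outer R n n.+1).-cara.-measurable E ->
  (0 < hausdorff R n n.+1 E < +oo)%E ->
  {ae hausdorff R n n.+1, forall x : 'rV[R]_n.+1, E x ->
    (hausdorff R n n.+1 E `^ (- (s * p / n%:R)) <=
     C%:E * (\int[hausdorff R n n.+1]_(y in boundary Omega `\` E)
               ((enorm (x - y)) `^ (- (n%:R + s * p)))%:E
             + nonlocal_mean_curvature alpha Omega x `^ (s * p / alpha)))%E}.
Proof.
case: n n_ge1 => [//|n] _.
have /andP[alpha0 _] := alpha_01; have /andP[s0 _] := s_01.
pose q := s * p; have q0 : 0 < q by rewrite mulr_gt0.
rewrite -/q; pose N : R := n.+1%:R.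
have N0 : 0 < N by rewrite ltr0n.
pose om : R := unit_ball_volume R n.+1.
have om0 : 0 < om by exact: unit_ball_volume_gt0.
(* The constant 4 (2 / om) ^ (1 / N) is such that om (r / 4) ^ N = 2 m for
   r = theta m ^ (1 / N). *)
pose theta : R := 4 * (2 / om) `^ N^-1.
have theta0 : 0 < theta by rewrite mulr_gt0// powR_gt0// divr_gt0.
pose K : R := n.+2%:R * (6 * theta).
have K0 : 0 < K by apply: mulr_gt0; [rewrite ltr0n|exact: mulr_gt0].
pose C1 : R := K `^ (N + q).
have C10 : 0 < C1 by rewrite powR_gt0.
pose c2 : R := (alpha / 2 * (theta `^ (N + 1) * K `^ (- (N + 1 + alpha)))) `^ (q / alpha).
have c20 : 0 < c2.
  apply: powR_gt0; apply: mulr_gt0; first by rewrite divr_gt0.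
  by apply: mulr_gt0; exact: powR_gt0.
exists (C1 + c2^-1) => [|Omega oO cO E Ebd mE /andP[HE0 HEoo]].
  by rewrite addr_gt0// invr_gt0.
apply: aeW => x Ex.
pose m := fine (hausdorff R n.+1 n.+2 E).
have HE : hausdorff R n.+1 n.+2 E = m%:E.
  by rewrite fineK// ge0_fin_numE// ltW.
have m0 : 0 < m by rewrite -lte_fin -HE.
rewrite HE poweR_EFin.
set I := (\int[_]_(y in _) _)%E.
set Hq := (nonlocal_mean_curvature alpha Omega x `^ _)%E.
have I0 : (0 <= I)%E by apply: integral_ge0 => y _; rewrite lee_fin powR_ge0.
have Hq0 : (0 <= Hq)%E by exact: poweR_ge0.
have xO : ~ Omega x.
  by have [_] := Ebd x Ex; rewrite (interior_id _).1.
pose r := theta * m `^ N^-1.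
have r0 : 0 < r by rewrite mulr_gt0// powR_gt0.
have rad : n.+2%:R * (6 * r) = K * m `^ N^-1 by rewrite /r /K !mulrA.
have [[a aB]|[v wide]] := exterior_box_or_wide_boundary oO cO xO r0.
- have := nonlocal_mean_curvature_ge alpha0 oO cO xO r0 aB.
  set h := (X in (X%:E <= _)%E) => hH.
  have h0 : 0 <= h.
    apply: mulr_ge0; first by rewrite divr_ge0// ltW.
    by rewrite mulr_ge0 ?powR_ge0// exprn_ge0// ltW.
  have hE : h `^ (q / alpha) = c2 * m `^ (- (q / N)).
    have NE : n.+2%:R = N + 1 by rewrite /N natr1.
    have rE : r ^+ n.+2 = r `^ (N + 1) by rewrite -NE powR_mulrn// ltW.
    rewrite /h rad rE NE; exact: scaling_curvature.
  apply: (@le_trans _ _ ((c2^-1)%:E * Hq)%E); last first.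
    apply: lee_pmul => //; rewrite ?lee_fin ?invr_ge0 ?(ltW c20)//.
      by rewrite lerDr ltW.
    by rewrite leeDr.
  apply: (@le_trans _ _ ((c2^-1)%:E * (h `^ (q / alpha))%:E)%E).
    by rewrite -EFinM hE lee_fin mulKf// gt_eqF.
  apply: lee_wpmul2l; first by rewrite lee_fin invr_ge0 ltW.
  rewrite -poweR_EFin; apply: gt0_ler_poweR => //.
  + by rewrite divr_ge0// ltW.
  + by rewrite in_itv/= leey andbT lee_fin.
  + by rewrite in_itv/= leey andbT; apply: le_trans hH; rewrite lee_fin.
- have two_m : 2 * m <= om * (r / 4) ^+ n.+1.
    have -> : r / 4 = (2 / om * m) `^ N^-1.
      by rewrite powRM ?divr_ge0 ?ltW// /r /theta; field.
    rewrite -powR_mulrn ?powR_ge0// -powRrM mulVf ?gt_eqF// powRr1.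
      by rewrite mulrA mulrCA divff ?mulr1 ?gt_eqF.
    by rewrite mulr_ge0 ?divr_ge0 ?ltW.
  have := boundary_integral_ge r0 q0 Ex mE HE two_m wide.
  rewrite rad scaling_integral// => I_ge.
  apply: (@le_trans _ _ (C1%:E * I)%E); last first.
    apply: lee_pmul => //; rewrite ?lee_fin ?(ltW C10)//.
      by rewrite lerDl invr_ge0 ltW.
    by rewrite leeDl.
  apply: (@le_trans _ _ (C1%:E * (K `^ (- (N + q)) * m `^ (- (q / N)))%:E)%E).
    by rewrite -EFinM lee_fin (powRN K) -/C1 mulVKf// gt_eqF.
  by apply: lee_wpmul2l => //; rewrite lee_fin ltW.
Qed.
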